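(* Let $\hat S^{\nu}_{2}$ be the Pick-Freeze $U$-statistic estimator, based on sample size $N$, of the ball sensitivity numerator $S^{\nu}_{2}$ (both defined in the context). Then $\hat S^{\nu}_{2}$ is a (strongly) consistent estimator of $S^{\nu}_{2}$: $\hat S^{\nu}_{2}\to S^{\nu}_{2}$ almost surely as $N\to\infty$.
   Context: Setting. $(\mathcal{M},g)$ is a connected, oriented Riemannian manifold such that, with the Riemannian distance $d_g$, $(\mathcal{M},d_g)$ is a complete separable metric space. $X=(X_1,\dots,X_d)\in\mathbb{R}^d$ is a random vector with independent components, $f:\mathbb{R}^d\to\mathcal{M}$ is continuous, and $Z=f(X_1,\dots,X_d)$. The law of $Z$ has a density with respect to the volume measure of $\mathcal{M}$, and two independent copies of $Z$ are, with probability one, joined by a unique minimizing geodesic. For $p,q\in\mathcal{M}$ joined by a unique minimizing geodesic, $B_{pq}$ denotes the closed ball whose center is the midpoint of that geodesic and whose radius is $d_g(p,q)/2$, and $h_{p,q}:\mathcal{M}\to\{0,1\}$ is the indicator function of $B_{pq}$. Fix $\nu\subset\{1,\dots,d\}$, and let $X_\nu=(X_i)_{i\in\nu}$. With $Z_1,Z_2$ independent copies of $Z$, independent of $X$, define $$S^{\nu}_{2}=\mathbb{E}_{Z_1,Z_2}\left[\mathrm{Var}_{X_\nu}\left\{\mathbb{E}_Z\left[h_{Z_1,Z_2}(Z)\mid X_\nu\right]\right\}\right],$$ where for fixed values of $Z_1,Z_2$ the inner conditional expectation and variance are with respect to $X$ (and $Z=f(X)$), and the outer expectation is over $(Z_1,Z_2)$.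 Pick-Freeze: let $X'$ be an independent copy of $X$, and let $X^{\nu}$ be the random vector whose components with index in $\nu$ are those of $X$ and whose components with index in $\{1,\dots,d\}\setminus\nu$ are those of $X'$. Set $Z^{\nu}=f(X^{\nu})$. Sample: $(Z_j,Z_j^{\nu})$, $j\ge 1$, are independent copies of $(Z,Z^{\nu})$, and $W_k$, $k\ge 1$, are independent copies of $Z$, independent of the $(Z_j,Z_j^{\nu})$; the estimator of sample size $N$ uses the first $N$ of each. Let $\mathcal{P}_{N,2}=\{(k_1,k_2)\in\{1,\dots,N\}^2: k_1<k_2\}$ and, for $\tau=(k_1,k_2)\in\mathcal{P}_{N,2}$, write $\mathbf{W}_\tau=(W_{k_1},W_{k_2})$ and $h_{\mathbf{W}_\tau}=h_{W_{k_1},W_{k_2}}$. Estimator: $$\hat S^{\nu}_{2}=\frac{1}{\binom{N}{2}}\sum_{\tau\in\mathcal{P}_{N,2}}\left\{\frac1N\sum_{j=1}^N h_{\mathbf{W}_\tau}(Z_j)\,h_{\mathbf{W}_\tau}(Z_j^{\nu})-\left(\frac{1}{2N}\sum_{j=1}^N\left[h_{\mathbf{W}_\tau}(Z_j)+h_{\mathbf{W}_\tau}(Z_j^{\nu})\right]\right)^2\right\}.$$ *)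

(* Defs.v *)
From HB Require Import structures.
From mathcomp Require Import all_boot all_order all_algebra.
From mathcomp Require Import all_classical all_reals all_analysis.

Set Implicit Arguments.
Unset Strict Implicit.
Unset Printing Implicit Defensive.
Import Order.TTheory GRing.Theory Num.Theory.
Import numFieldNormedType.Exports.
Local Open Scope classical_set_scope.
Local Open Scope ring_scope.

(* [Complete] includes a distinguished point, which [measurableType] requires. *)
#[short(type="completePMetricType")]
HB.structure Definition CompletePMetric (R : numDomainType) :=
  {M of Metric R M & Complete M}.

Notation borel T := (g_sigma_algebraType (@open T)).

Definition separable (T : topologicalType) : Prop :=
  exists2 D : set T, countable D & dense D.

Fixpoint Ck (R : realType) (n k : nat) (U : set 'rV[R]_n) (F : 'rV[R]_n -> R)
    : Prop :=
  (forall x, U x -> {for x, continuous F}) /\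
  (if k is k'.+1 then
     forall a : 'I_n, (forall x, U x -> derivable F x (delta_mx 0 a)) /\
       Ck k' U (fun x => 'D_(delta_mx 0 a) F x)
   else True).

Definition smooth_on (R : realType) (n : nat) (U : set 'rV[R]_n)
    (F : 'rV[R]_n -> R) : Prop := forall k, Ck k U F.

(* A Riemannian metric on an oriented smooth [n]-manifold whose underlying
   topological space is [M], given by an oriented atlas. The chart [i] has
   domain [dom i], coordinates [phi i] and inverse [psi i]; [gram i x] is the
   Gram matrix of the metric tensor, in the coordinates of the chart [i], at the
   point of coordinates [x]. Tangent vectors are row vectors, so that the
   transition map [T] sends [v] to [v *m jacobian T x]. *)
Record orientedRiemannian (R : realType) (n : nat) (M : topologicalType) := {
  chart : Type ;
  dom : chart -> set M ;
  phi : chart -> M -> 'rV[R]_n ;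
  psi : chart -> 'rV[R]_n -> M ;
  gram : chart -> 'rV[R]_n -> 'M[R]_n ;
  dom_cover : forall p, exists i, dom i p ;
  dom_open : forall i, open (dom i) ;
  img_open : forall i, open (phi i @` dom i) ;
  phiK : forall i p, dom i p -> psi i (phi i p) = p ;
  phi_continuous : forall i p, dom i p -> {for p, continuous (phi i)} ;
  psi_continuous : forall i x, (phi i @` dom i) x ->
    {for x, continuous (psi i)} ;
  transition_smooth : forall i j (b : 'I_n),
    smooth_on (phi i @` (dom i `&` dom j)) (fun x => phi j (psi i x) 0 b) ;
  transition_oriented : forall i j x, (phi i @` (dom i `&` dom j)) x ->
    0 < \det (jacobian (phi j \o psi i) x) ;
  gram_smooth : forall i a b, smooth_on (phi i @` dom i) (fun x => gram i x a b) ;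
  gram_sym : forall i x, (phi i @` dom i) x -> (gram i x)^T = gram i x ;
  gram_pos : forall i x (v : 'rV[R]_n), (phi i @` dom i) x -> v != 0 ->
    0 < (v *m gram i x *m v^T) 0 0 ;
  gram_transition : forall i j x, (phi i @` (dom i `&` dom j)) x ->
    gram i x = jacobian (phi j \o psi i) x *m gram j (phi j (psi i x))
                 *m (jacobian (phi j \o psi i) x)^T
}.

Definition speed (R : realType) n (M : topologicalType)
    (g : orientedRiemannian R n M) (i : chart g) (c : R -> 'rV[R]_n) (t : R) : R :=
  Num.sqrt (('D_1 c t *m gram i (c t) *m ('D_1 c t)^T) 0 0).

(* [curve_length g p q L]: [L] is the length of some piecewise C^1 curve from [p]
   to [q]. By compactness, such a curve is a finite concatenation of C^1 curves,
   each contained in the domain of one chart; after an affine change of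
   parameter each of these is defined on [0, 1], and it extends to a C^1 map on
   R, of which only the restriction to [0, 1] matters. *)
Inductive curve_length (R : realType) n (M : topologicalType)
    (g : orientedRiemannian R n M) : M -> M -> \bar R -> Prop :=
| curve_length_chart (i : chart g) (c : R -> 'rV[R]_n) :
    (forall t, derivable c t 1) -> continuous (fun t => 'D_1 c t) ->
    (forall t, 0 <= t <= 1 -> (phi i @` dom i) (c t)) ->
    curve_length g (psi i (c 0)) (psi i (c 1))
      (\int[@lebesgue_measure R]_(t in `[0%R, 1%R]) (speed i c t)%:E)%E
| curve_length_cat (p q r : M) (L L' : \bar R) :
    curve_length g p q L -> curve_length g q r L' ->
    curve_length g p r (L + L')%E.

(* The distance that comes with the type [M] is the Riemannian distance of [g];
   in particular the metric topology is the manifold topology. *)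
Definition riemannian_distance (R : realType) n (M : completePMetricType R)
    (g : orientedRiemannian R n M) : Prop :=
  forall p q : M, (mdist p q)%:E = ereal_inf [set L | curve_length g p q L].

(* Lebesgue measure on R^n, characterised by its values on boxes. *)
Definition is_lebesgue (R : realType) n
    (lam : {measure set (borel 'rV[R]_n) -> \bar R}) : Prop :=
  forall a b : 'rV[R]_n, (forall i, a 0 i <= b 0 i) ->
    lam [set x : 'rV[R]_n | forall i, a 0 i < x 0 i <= b 0 i] =
    (\prod_(i < n) (b 0 i - a 0 i))%:E.

(* [vol] is the volume measure of [g]: sqrt(det g) dx in every chart. *)
Definition is_volume (R : realType) n (M : completePMetricType R)
    (g : orientedRiemannian R n M)
    (lam : {measure set (borel 'rV[R]_n) -> \bar R})
    (vol : {measure set (borel M) -> \bar R}) : Prop :=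
  forall (i : chart g) (A : set (borel M)), measurable A -> A `<=` dom i ->
    vol A = (\int[lam]_(x in phi i @` A) (Num.sqrt (\det (gram i x)))%:E)%E.

(* Minimizing geodesics with respect to the distance [mdist], parametrised on
   [0, 1] with constant speed: curves realising the distance between any two of
   their points. On a Riemannian manifold these are smooth. The values of [gamma]
   outside [0, 1] are irrelevant. *)
Definition minimizing_geodesic (R : realType) (M : completePMetricType R)
    (p q : M) (gamma : R -> M) : Prop :=
  [/\ gamma 0 = p, gamma 1 = q &
      forall s t, 0 <= s -> s <= t -> t <= 1 ->
        mdist (gamma s) (gamma t) = (t - s) * mdist p q].

Definition unique_minimizing_geodesic (R : realType) (M : completePMetricType R)
    (p q : M) (gamma : R -> M) : Prop :=
  minimizing_geodesic p q gamma /\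
  forall gamma', minimizing_geodesic p q gamma' ->
    forall t, 0 <= t <= 1 -> gamma' t = gamma t.

(* The ball B_pq, with the convention that it is empty if [p] and [q] are not
   joined by a unique minimizing geodesic. *)
Definition geodesic_ball (R : realType) (M : completePMetricType R) (p q : M)
    : set M :=
  [set z | exists2 gamma, unique_minimizing_geodesic p q gamma &
             mdist (gamma 2^-1) z <= mdist p q / 2].

Definition ball_ind (R : realType) (M : completePMetricType R) (p q z : M) : R :=
  \1_(geodesic_ball p q) z.

Definition sigma_of (T : Type) d' (T' : measurableType d') (Y : T -> T')
    : set (set T) :=
  preimage_set_system [set: T] Y measurable.

Definition mutually_independent d (T : measurableType d) (R : realType)
    (P : probability T R) (I : eqType) (F : I -> set (set T)) : Prop :=
  forall (s : seq I) (A : I -> set T), uniq s ->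
    (forall i, i \in s -> F i (A i)) ->
    P (\bigcap_(i in [set` s]) A i) = (\prod_(i <- s) fine (P (A i)))%:E.

Definition same_law d (T : measurableType d) (R : realType)
    (P : probability T R) d' (T' : measurableType d') (Y Y' : T -> T') : Prop :=
  forall B, measurable B -> P (Y @^-1` B) = P (Y' @^-1` B).

Definition is_cond_exp d (T : measurableType d) (R : realType)
    (P : probability T R) (G : set (set T)) (Y V : T -> R) : Prop :=
  [/\ P.-integrable [set: T] (EFin \o V),
      forall B, measurable B -> G (V @^-1` B) &
      forall A, G A ->
        (\int[P]_(w in A) (V w)%:E = \int[P]_(w in A) (Y w)%:E)%E].

(* A version of E[Y | G]. *)
Definition cond_exp d (T : measurableType d) (R : realType)
    (P : probability T R) (G : set (set T)) (Y : T -> R) : T -> R :=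
  xget (cst 0) [set V | is_cond_exp P G Y V].

Definition component (R : realType) (m : nat) (T : Type)
    (X : T -> 'rV[R]_m) (i : 'I_m) : T -> R := fun w => X w 0 i.

Definition sigma_coords (R : realType) (m : nat) (T : Type)
    (X : T -> 'rV[R]_m) (nu : {set 'I_m}) : set (set T) :=
  <<s \bigcup_(i in [set` nu]) sigma_of (component X i) >>.

(* X^nu: the components in [nu] are those of X, the other ones those of X'. *)
Definition pick_freeze (R : realType) (m : nat) (T : Type) (nu : {set 'I_m})
    (X X' : T -> 'rV[R]_m) : T -> 'rV[R]_m :=
  fun w => \row_i (if i \in nu then X w 0 i else X' w 0 i).

(* S^nu_2; [Z1] and [Z2] are random, and for fixed values p, q of them the inner
   variance and conditional expectation are taken with respect to X. *)
Definition sensitivity d (T : measurableType d) (R : realType)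
    (P : probability T R) (M : completePMetricType R) (m : nat)
    (f : 'rV[R]_m -> M) (nu : {set 'I_m}) (X : T -> 'rV[R]_m) (Z1 Z2 : T -> M)
    : R :=
  let G := sigma_coords X nu in
  let V p q := fine 'V_P[cond_exp P G (fun w => ball_ind p q (f (X w)))] in
  fine 'E_P[fun w => V (Z1 w) (Z2 w)].

(* The Pick-Freeze estimator based on the first [N] terms of the samples; sample
   indices start at 0. *)
Definition estimator (R : realType) (M : completePMetricType R) (T : Type)
    (Zs Znus Ws : nat -> T -> M) (N : nat) (w : T) : R :=
  ('C(N, 2)%:R)^-1 *
  \sum_(tau : 'I_N * 'I_N | (tau.1 < tau.2)%N)
    let h z := ball_ind (Ws tau.1 w) (Ws tau.2 w) z in
    (N%:R^-1 * \sum_(j < N) h (Zs j w) * h (Znus j w)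
     - ((2 * N%:R)^-1 * \sum_(j < N) (h (Zs j w) + h (Znus j w))) ^+ 2).

(* Main.v *)
Require Import Defs.
From HB Require Import structures.
From mathcomp Require Import all_boot all_order all_algebra.
From mathcomp Require Import all_classical all_reals all_analysis.
From mathcomp Require Import measurable_realfun.
From mathcomp Require finmap.
From mathcomp Require Import ring lra zify.
Import Order.TTheory GRing.Theory Num.Theory.
Import numFieldNormedType.Exports.
Local Open Scope classical_set_scope.
Local Open Scope ring_scope.

Set Implicit Arguments.
Unset Strict Implicit.
Unset Printing Implicit Defensive.

(** The estimator is the average of a bounded kernel over quadruples of sample indices,
    and the theorem is a strong law of large numbers for this average. Write
    [h = ball_ind p q], and [h'] and [h''] for its values at [Z] and at its pick-freeze
    copy. The square of the average over [j] is a double average over [j] and [l], so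
    that one plus the estimator is the average over [((k1, k2), (j, l))], [k1 < k2], of
    a [kernel] with values in [[0, 2]] ([estimatorE]).

    Mean of the kernel. For distinct indices the four sample points are independent, and
    the mean for fixed [p] and [q] is [1 + E(h' h'') - (E h')^2]. Given [X_nu], the
    vectors [X] and [X^nu] are independent with the same law, so that
    [E(h' h'') = E(E(h' | X_nu)^2)] ([pick_freeze_product]); hence the mean is one plus
    the variance of [E(h' | X_nu)] ([kernel_conditional_variance]). Averaging over
    [(p, q) = (Z1, Z2)] gives one plus the sensitivity. Conditional expectations are
    unique up to null sets, so the chosen version does not matter ([cond_exp_ae]).

    Law of large numbers. Kernel values at two quadruples without common index and
    with [j != l] are independent with the same mean, and all but at most [10 * N ^ 7]
    pairs of quadruples are of this kind, among order [N ^ 8] pairs: the average has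
    variance of order [1 / N]. It converges almost surely along the squares, where these
    bounds are summable, and then along all [N] because the kernel is nonnegative and
    the sums increase ([quad_slln]).

    Measurability. All of this needs [ball_ind p q z] to be jointly measurable in [p], [q]
    and [z], although [B_pq] is defined by the existence and uniqueness of a geodesic.
    A Riemannian distance makes a complete manifold a locally compact length space, so
    closed balls are compact by the Hopf-Rinow argument ([compact_cball]). Compactness
    lets exact and approximate points between [p] and [q] be compared: the minimizing
    geodesic is unique if and only if, at each rational parameter, the sets of
    approximate points have diameters tending to zero ([exists_unique_geodesicP]). On
    a dense sequence this is a countable combination of inequalities between distances,
    and so is membership in [B_pq] ([measurable_geodesic_ball]). *)

(** * Compactness in complete metric spaces *)

Section MetricCompactness.
Context {R : realType} (M : completePMetricType R).
Implicit Types (p q x y z : M) (r s e : R).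

Definition cball p r : set M := [set y | mdist p y <= r].

Lemma nbhs_ballm p e : 0 < e -> nbhs p [set y | mdist p y < e].
Proof. by move=> e0; rewrite -ballEmdist; exact: nbhsx_ballx. Qed.

Lemma nbhs_mdist p (A : set M) :
  nbhs p A <-> exists2 e, 0 < e & [set y | mdist p y < e] `<=` A.
Proof.
rewrite -nbhs_ballE; split => [[e /= e0 eA]|[e e0 eA]]; exists e => //.
  by rewrite -ballEmdist.
by rewrite ballEmdist.
Qed.

Lemma closed_cball p r : closed (cball p r).
Proof.
move=> x clx; rewrite /cball /=; apply/ler_addgt0Pl => e e0.
have [y [/= py xy]] := clx _ (nbhs_ballm x e0).
rewrite (le_trans (metric_triangle p y x))// addrC lerD//.
by rewrite metric_sym ltW.
Qed.

(** An ultrafilter on a totally bounded set contains balls of every radius, hence is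
    Cauchy. *)
Lemma totally_bounded_compact (A : set M) : closed A ->
  (forall e, 0 < e -> exists s : seq M,
     forall x, A x -> exists2 y, y \in s & mdist y x < e) ->
  compact A.
Proof.
move=> Acl Atb; rewrite compact_ultra => F UF FA.
have FF : ProperFilter F by exact: ultra_proper.
have cF : cauchy F.
  apply: cauchy_exP => e e0; have [s As] := Atb _ e0.
  have [y _ Fy] : exists2 y, y \in s & F [set x | mdist y x < e].
    have : F [set x | exists2 y, y \in s & mdist y x < e] by apply: filterS FA.
    elim: s {As} => [F0|y s IH Fs].
      have : F set0 by apply: filterS F0 => x [].
      by move/filter_not_empty.
    have [Fy|nFy] := in_ultra_setVsetC [set x | mdist y x < e] UF.
      by exists y => //; rewrite inE eqxx.
    have [|z zs Fz] := IH.
      apply: filterS (filterI Fs nFy) => x [[z]]; rewrite inE => /orP[/eqP->//|zs].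
      by move=> zx _; exists z.
    by exists z => //; rewrite inE zs orbT.
  by exists y; rewrite ballEmdist.
have /cvg_ex[l Fl] : cvg F by exact: cauchy_cvg.
exists l; split => //; apply: Acl => B /Fl FB.
exact: (filter_ex (filterI FA FB)).
Qed.

Lemma compact_net (K : set M) e : compact K -> 0 < e ->
  exists s : seq M, (forall y, y \in s -> K y) /\
    forall x, K x -> exists2 y, y \in s & mdist y x < e.
Proof.
rewrite compact_cover => cK e0.
have [|x Kx|D' D'K K'] := cK M K (fun p => [set y | mdist p y < e]).
- move=> p _; rewrite openE => x /= px; apply/nbhs_mdist; exists (e - mdist p x).
    by rewrite subr_gt0.
  by move=> y /= xy; have := metric_triangle p x y; lra.
- by exists x => //=; rewrite mdistxx.
exists (finmap.enum_fset D'); split => [y yD|x /K'[y yD yx]].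
  by have := D'K y yD; rewrite inE.
by exists y.
Qed.

End MetricCompactness.

(** * Closed balls of complete locally compact length spaces *)

Section HopfRinow.
Context {R : realType} (M : completePMetricType R).
Implicit Types (p q x y z : M) (r s e : R).

Definition length_space := forall p q s e, 0 <= s <= mdist p q -> 0 < e ->
  exists2 m, mdist p m <= s & mdist m q < mdist p q - s + e.

Hypothesis lenM : length_space.

(** An almost shortest path to a point of the ball passes through a smaller ball close to
    that point, so that a finite net of the latter is one of the former. *)
Lemma compact_cball_left p r :
  (forall e, 0 < e -> compact (cball p (r - e))) -> compact (cball p r).
Proof.
move=> cr; apply: totally_bounded_compact; first exact: closed_cball.
move=> e e0; have e4 : 0 < e / 4 by rewrite divr_gt0.
have [re|er] := ltP r e.
  exists [:: p] => x px; exists p; rewrite ?inE//.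
  exact: le_lt_trans px re.
have [s [_ sK]] := compact_net (cr _ e4) e4.
exists s => x px; have [px'|px'] := leP (mdist p x) (r - e / 4).
  by have [y ys yx] := sK x px'; exists y => //; lra.
have [||m pm mx] := @lenM p x (mdist p x - e / 2) (e / 4) => //.
  by apply/andP; split; lra.
have [|y ys ym] := sK m; first by move: px; rewrite /cball/=; lra.
by exists y => //; have := metric_triangle y m x; lra.
Qed.

(** By compactness the closed balls of one radius [e] around the points of the ball are
    compact, and finitely many of them cover a slightly larger ball. *)
Lemma compact_cball_right p r : (forall x, exists2 e, 0 < e & compact (cball x e)) ->
  0 <= r -> compact (cball p r) -> exists2 e, 0 < e & compact (cball p (r + e)).
Proof.
move=> loc r0 cr.
have [e e0 ce] : exists2 e, 0 < e & forall x, cball p r x -> compact (cball x e).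
  have /(_ R (0^'+) (fun e x => compact (cball x e)) _)H :=
    (compact_near_coveringP _).1 cr.
  have {}H : \forall e \near 0^'+, cball p r `<=` (fun x => compact (cball x e)).
    apply: H => x _; have [a a0 ca] := loc x; have a2 : 0 < a / 2 by rewrite divr_gt0.
    exists ([set y | mdist x y < a / 2], [set e | 0 < e < a / 2]).
      split; first exact: nbhs_ballm.
      near=> e; apply/andP; split; near: e; first exact: nbhs_right_gt.
      exact: nbhs_right_lt.
    move=> [y e] /= [xy /andP[e0 ea]].
    apply: subclosed_compact ca _; first exact: closed_cball.
    by move=> z; rewrite /cball/= => yz; have := metric_triangle x y z; lra.
  have [e [e0 He]] := filter_ex (filterI (@nbhs_right_gt R 0) H).
  by exists e.
have e2 : 0 < e / 2 by rewrite divr_gt0.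
have e4 : 0 < e / 4 by rewrite divr_gt0.
exists (e / 4) => //.
have [s [sK Ks]] := compact_net cr e2.
apply: (@subclosed_compact _ _ (\big[setU/set0]_(x <- s) cball x e)).
- exact: closed_cball.
- by rewrite big_seq; apply: bigsetU_compact => x xs; exact/ce/sK.
move=> x px.
suff [y ys yx] : exists2 y, y \in s & mdist y x <= e.
  by rewrite -bigcup_seq; exists y.
have [pxr|rpx] := leP (mdist p x) r.
  by have [y ys yx] := Ks x pxr; exists y => //; lra.
have [|m pm mx] := @lenM p x r _ _ e4; first by rewrite r0 ltW.
have [y ys ym] := Ks m pm; exists y => //.
by have := metric_triangle y m x; move: px; rewrite /cball/=; lra.
Unshelve. all: by end_near. Qed.

(** The radii of the compact closed balls centred at a point form an interval
    which is closed by completeness and open by local compactness. *)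
Lemma compact_cball p r : (forall x, exists2 e, 0 < e & compact (cball x e)) ->
  compact (cball p r).
Proof.
move=> loc; pose S := [set s | compact (cball p s)].
have Sdown s s' : s' <= s -> S s -> S s'.
  move=> s's Ss; apply: subclosed_compact Ss _; first exact: closed_cball.
  by move=> x; rewrite /cball/= => /le_trans; exact.
apply: contrapT => nSr.
have S0 : S 0 by have [e /ltW e0 ce] := loc p; exact: (Sdown _ _ e0 ce).
have ubS : ubound S r.
  move=> s Ss; rewrite leNgt; apply/negP => rs.
  by apply: nSr; exact: (Sdown _ _ (ltW rs) Ss).
have supS : has_sup S by split; [exists 0|exists r].
have Ssup : S (sup S).
  apply: compact_cball_left => e e0.
  by have [s Ss /ltW se] := sup_adherent e0 supS; exact: (Sdown _ _ se Ss).
have sup0 : 0 <= sup S by apply: ub_le_sup => //; exact: supS.2.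
have [e e0 Se] := compact_cball_right loc sup0 Ssup.
have : sup S + e <= sup S by apply: ub_le_sup => //; exact: supS.2.
lra.
Qed.

End HopfRinow.

(** * Geodesics of proper length spaces *)

Section Geodesics.
Context {R : realType} (M : completePMetricType R).
Implicit Types (p q x y z m : M) (r s t e : R).

Hypothesis lenM : length_space M.
Hypothesis properM : forall p r, compact (cball p r).

(** Approximate points of parameter [t] on minimizing geodesics from [p] to [q]. For
    [e > 0] this is an open set, so that its size can be tested on a dense sequence. *)
Definition between t e p q : set M :=
  [set m | mdist p m < t * mdist p q + e /\ mdist m q < (1 - t) * mdist p q + e].

Definition between0 t p q : set M :=
  [set m | mdist p m <= t * mdist p q /\ mdist m q <= (1 - t) * mdist p q].

(** By compactness, sets that meet every approximate [between] have a limit point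
    in the exact one. *)
Lemma between_cluster t p q (C : set M) : closed C ->
  (forall e, 0 < e -> between t e p q `&` C !=set0) ->
  between0 t p q `&` C !=set0.
Proof.
move=> Ccl BC.
pose F := filter_from [set e : R | 0 < e] (fun e => between t e p q `&` C).
have FF : ProperFilter F.
  apply: filter_from_proper => [|e e0]; last exact: BC.
  apply: filter_from_filter; first by exists 1; exact: ltr01.
  move=> e e' /= e0 e'0; exists (Num.min e e'); first by rewrite /= lt_min e0.
  move=> m [[pm mq] Cm]; have := ge_min e e e'; have := ge_min e' e e'.
  rewrite !lexx orbT/= => e1 e2.
  by split; split=> //; split; lra.
have FC : F (cball p (t * mdist p q + 1)).
  by exists 1; [exact: ltr01|move=> m [[pm _] _]; rewrite /cball/=; lra].
have [m [_ Fm]] := properM FF FC.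
exists m; split; last first.
  apply: Ccl => B mB; have FC' : F C by exists 1; [exact: ltr01|move=> x []].
  exact: (Fm _ _ FC' mB).
have key e : 0 < e -> mdist p m < t * mdist p q + e /\
    mdist m q < (1 - t) * mdist p q + e.
  move=> e0; have e2 : 0 < e / 2 by rewrite divr_gt0.
  have Fe : F (between t (e / 2) p q) by exists (e / 2) => // x [].
  have [x [[px xq] /= mx]] := Fm _ _ Fe (nbhs_ballm m e2).
  have := metric_triangle p x m; have := metric_triangle m x q.
  by rewrite (metric_sym x m); split; lra.
split; apply/ler_addgt0Pl => e /key[k1 k2]; rewrite addrC; exact: ltW.
Qed.

Lemma between0_nonempty t p q : 0 <= t <= 1 -> between0 t p q !=set0.
Proof.
move=> /andP[t0 t1]; have d0 := mdist_ge0 p q.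
have [|m [? _]] := @between_cluster t p q setT closedT _; last by exists m.
move=> e e0; have [|m pm mq] := @lenM p q (t * mdist p q) _ _ e0.
  by rewrite mulr_ge0//= -[leRHS]mul1r ler_wpM2r.
by exists m; split => //; split; lra.
Qed.

Lemma between0E t p q m : between0 t p q m ->
  mdist p m = t * mdist p q /\ mdist m q = (1 - t) * mdist p q.
Proof. by move=> [pm mq]; have := metric_triangle p m q; split; lra. Qed.

Definition midpoint p q : M := xget p (between0 2^-1 p q).

Lemma midpointE p q : mdist p (midpoint p q) = 2^-1 * mdist p q /\
  mdist (midpoint p q) q = 2^-1 * mdist p q.
Proof.
have [m mB] : between0 2^-1 p q !=set0 by apply: between0_nonempty; lra.
have : between0 2^-1 p q (midpoint p q) by apply: (xgetI _ mB).
by move/between0E => [-> ->]; split; lra.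
Qed.

(** A step function on the dyadic subdivision of order [n] of [[0, 1]]; its values are
    the points obtained by [n] bisections of the pair [(p, q)]. *)
Fixpoint bisect n p q t : M :=
  if n is n'.+1 then
    if t <= 2^-1 then bisect n' p (midpoint p q) (2 * t)
    else bisect n' (midpoint p q) q (2 * t - 1)
  else if t < 1 then p else q.

Lemma bisect0 n p q : bisect n p q 0 = p.
Proof.
elim: n p q => [|n IH] p q /=; first by rewrite ltr01.
by rewrite invr_ge0 ler0n mulr0.
Qed.

Lemma bisect1 n p q : bisect n p q 1 = q.
Proof.
elim: n p q => [|n IH] p q /=; first by rewrite ltxx.
by case: ifP => [h|_]; [exfalso; lra|rewrite (_ : 2 * 1 - 1 = 1)//; lra].
Qed.

Lemma bisect_between n p q t : 0 <= t <= 1 ->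
  mdist p (bisect n p q t) <= t * mdist p q + 2^-1 ^+ n * mdist p q /\
  mdist (bisect n p q t) q <= (1 - t) * mdist p q + 2^-1 ^+ n * mdist p q.
Proof.
elim: n p q t => [|n IH] p q t t01 /=; have d0 := mdist_ge0 p q.
  by rewrite expr0; case: ifP => t1; rewrite mdistxx; split; nra.
have [pm mq] := midpointE p q; rewrite exprS; case: ifPn => t2.
  have [|h1 h2] := IH p (midpoint p q) (2 * t); first lra.
  have := metric_triangle (bisect n p (midpoint p q) (2 * t)) (midpoint p q) q.
  by rewrite pm in h1 h2; split; lra.
have [|h1 h2] := IH (midpoint p q) q (2 * t - 1); first lra.
have := metric_triangle p (midpoint p q) (bisect n (midpoint p q) q (2 * t - 1)).
by rewrite mq in h1 h2; split; lra.
Qed.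

(** Each endpoint contributes an error of [2^-1 ^+ n]. *)
Lemma bisect_dist n p q s t : 0 <= s -> s <= t -> t <= 1 ->
  mdist (bisect n p q s) (bisect n p q t) <=
    (t - s) * mdist p q + 2 * 2^-1 ^+ n * mdist p q.
Proof.
elim: n p q s t => [|n IH] p q s t s0 st t1 /=; have d0 := mdist_ge0 p q.
  rewrite expr0; case: ifP => s1; case: ifP => t1'; rewrite ?mdistxx.
  - nra.
  - nra.
  - lra.
  - nra.
have [pm mq] := midpointE p q; rewrite exprS.
case: ifPn => s2; case: ifPn => t2.
- by have := IH p (midpoint p q) (2 * s) (2 * t); rewrite pm; lra.
- have [|_] := @bisect_between n p (midpoint p q) (2 * s); first lra.
  have [|+ _] := @bisect_between n (midpoint p q) q (2 * t - 1); first lra.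
  have := metric_triangle (bisect n p (midpoint p q) (2 * s)) (midpoint p q)
    (bisect n (midpoint p q) q (2 * t - 1)).
  by rewrite pm mq; lra.
- lra.
- by have := IH (midpoint p q) q (2 * s - 1) (2 * t - 1); rewrite mq; lra.
Qed.

Lemma bisect_step n p q t : 0 <= t <= 1 ->
  mdist (bisect n p q t) (bisect n.+1 p q t) <= 2^-1 ^+ n * mdist p q.
Proof.
elim: n p q t => [|n IH] p q t t01; have d0 := mdist_ge0 p q;
  have [pm mq] := midpointE p q.
  rewrite expr0 /=; case: ifPn => t1; case: ifPn => t2; case: ifPn => t3;
    rewrite ?mdistxx ?pm; lra.
rewrite exprS [X in mdist X _]/= [X in mdist _ X]/=.
case: ifPn => t2.
  by have := IH p (midpoint p q) (2 * t); rewrite pm /=; lra.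
by have := IH (midpoint p q) q (2 * t - 1); rewrite mq /=; lra.
Qed.

Lemma bisect_cauchy n k p q t : 0 <= t <= 1 ->
  mdist (bisect n p q t) (bisect (n + k) p q t) <= 2 * 2^-1 ^+ n * mdist p q.
Proof.
move=> t01; have d0 := mdist_ge0 p q.
suff : mdist (bisect n p q t) (bisect (n + k) p q t) <=
    2 * (2^-1 ^+ n - 2^-1 ^+ (n + k)) * mdist p q.
  have : 0 <= 2^-1 ^+ (n + k) * mdist p q by rewrite mulr_ge0.
  by move=> ?; lra.
elim: k => [|k IH]; first by rewrite addn0 mdistxx subrr; lra.
rewrite addnS; have := bisect_step (n + k) p q t01.
have := metric_triangle (bisect n p q t) (bisect (n + k) p q t)
  (bisect (n + k).+1 p q t).
by rewrite [2^-1 ^+ _.+1]exprS; lra.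
Qed.

Definition geodesic p q t : M := lim (bisect n p q t @[n --> \oo]).

Lemma half_small (c e : R) : 0 < e -> \forall n \near \oo, 2^-1 ^+ n * c < e.
Proof.
move=> e0.
have : 2^-1 ^+ n * c @[n --> \oo] --> (0 * c : R).
  by apply: cvgM; [apply: cvg_expr; rewrite ger0_norm; lra|exact: cvg_cst].
by rewrite mul0r => /cvgr_lt; apply.
Qed.

Lemma bisect_cvg p q t e : 0 <= t <= 1 -> 0 < e ->
  \forall n \near \oo, mdist (geodesic p q t) (bisect n p q t) < e.
Proof.
move=> t01 e0.
have : cauchy (bisect n p q t @[n --> \oo]).
  apply: cauchy_exP => r r0.
  have [N _ HN] := half_small (2 * mdist p q) r0.
  exists (bisect N p q t); exists N => // n /= Nn; rewrite ballEmdist /=.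
  have := @bisect_cauchy N (n - N) p q t t01; rewrite subnKC//.
  by have := HN N (leqnn N); rewrite /=; lra.
move=> cF; have : cvg (bisect n p q t @[n --> \oo]) by exact: cauchy_cvg.
by move/(_ _ (nbhs_ballm _ e0)).
Qed.

(** In the limit the bisections are Lipschitz with constant [mdist p q]; as the endpoints
    are at that distance, the triangle inequality forces equality throughout. *)
Lemma geodesic_minimizing p q : minimizing_geodesic p q (geodesic p q).
Proof.
have cst u t : (forall n, bisect n p q t = u) -> 0 <= t <= 1 -> geodesic p q t = u.
  move=> cu t01; apply: mdist_positivity; apply/eqP; rewrite eq_le mdist_ge0 andbT.
  apply/ler_addgt0Pl => e e0.
  by have [n] := filter_ex (bisect_cvg p q t01 e0); rewrite cu; lra.
have g0 : geodesic p q 0 = p by apply: cst => [n|]; [exact: bisect0|lra].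
have g1 : geodesic p q 1 = q by apply: cst => [n|]; [exact: bisect1|lra].
have gle s t : 0 <= s -> s <= t -> t <= 1 ->
    mdist (geodesic p q s) (geodesic p q t) <= (t - s) * mdist p q.
  move=> s0 st t1; apply/ler_addgt0Pl => e e0; have e3 : 0 < e / 3 by rewrite divr_gt0.
  have s01 : 0 <= s <= 1 by lra.
  have t01 : 0 <= t <= 1 by lra.
  have [n [[gs gt] hs]] := filter_ex (filterI (filterI (bisect_cvg p q s01 e3)
    (bisect_cvg p q t01 e3)) (half_small (2 * mdist p q) e3)).
  have := metric_triangle (geodesic p q s) (bisect n p q s) (geodesic p q t).
  have := metric_triangle (bisect n p q s) (bisect n p q t) (geodesic p q t).
  have := @bisect_dist n p q s t s0 st t1; rewrite (metric_sym (bisect n p q t) (geodesic p q t)) => h1 h2 h3.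
  move: gs gt hs => /= gs gt hs; lra.
split=> // s t s0 st t1; apply/eqP; rewrite eq_le gle//=.
have := gle 0 s; have := gle t 1; rewrite g0 g1.
have := metric_triangle p (geodesic p q s) q.
have := metric_triangle (geodesic p q s) (geodesic p q t) q.
lra.
Qed.

(** Concatenate a minimizing geodesic from [p] to [m] with one from [m] to [q]. *)
Lemma geodesic_through t p q m : 0 < t < 1 -> between0 t p q m ->
  exists2 gamma, minimizing_geodesic p q gamma & gamma t = m.
Proof.
move=> /andP[t0 t1] /between0E[pm mq].
have [a0 a1 aE] := geodesic_minimizing p m.
have [b0 b1 bE] := geodesic_minimizing m q.
pose g s := if s <= t then geodesic p m (s / t)
            else geodesic m q ((s - t) / (1 - t)).
have t1' : 0 < 1 - t by rewrite subr_gt0.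
have gt : g t = m by rewrite /g lexx divff ?gt_eqF.
exists g => //.
have g0 : g 0 = p by rewrite /g ltW// mul0r.
have g1 : g 1 = q by rewrite /g leNgt t1 /= divff ?gt_eqF.
have gle s s' : 0 <= s -> s <= s' -> s' <= 1 ->
    mdist (g s) (g s') <= (s' - s) * mdist p q.
  have lo (x y : R) : 0 <= x -> x <= y -> y <= t ->
      mdist (g x) (g y) <= (y - x) * mdist p q.
    move=> x0 xy yt; rewrite /g yt (le_trans xy yt).
    rewrite aE ?divr_ge0 ?ler_pM2r ?invr_gt0 ?ler_pdivrMr ?mul1r//; last exact: ltW.
    by rewrite pm -mulrBl mulrA divfK ?gt_eqF.
  have hi (x y : R) : t <= x -> x <= y -> y <= 1 ->
      mdist (g x) (g y) <= (y - x) * mdist p q.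
    have hi' (z : R) : t <= z -> g z = geodesic m q ((z - t) / (1 - t)).
      rewrite le_eqVlt => /predU1P[<-|tz]; first by rewrite gt subrr mul0r.
      by rewrite /g leNgt tz.
    move=> tx xy y1; rewrite (hi' _ tx) (hi' _ (le_trans tx xy)).
    rewrite bE ?divr_ge0 ?ler_pM2r ?invr_gt0 ?ler_pdivrMr ?mul1r ?subr_ge0//;
      do ?lra.
    by rewrite mq -mulrBl mulrA divfK ?gt_eqF//; lra.
  move=> s0 ss s1; have [s't|ts'] := leP s' t; first exact: lo.
  have [st|ts] := leP s t; last by apply: hi => //; exact: ltW.
  have := lo s t s0 st (lexx t); have := hi t s' (lexx t) (ltW ts') s1.
  by have := metric_triangle (g s) (g t) (g s'); lra.
split=> // s s' s0 ss s1; apply/eqP; rewrite eq_le gle//=.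
have := gle 0 s; have := gle s' 1; rewrite g0 g1.
have := metric_triangle p (g s) q.
have := metric_triangle (g s) (g s') q.
lra.
Qed.

End Geodesics.

(** * Measurability of geodesic balls *)

Section CountableQuantifiers.
Context d (T : measurableType d).

Lemma measurable_exists (I : countType) (A : I -> set T) :
  (forall i, measurable (A i)) -> measurable [set x | exists i, A i x].
Proof.
move=> mA; rewrite (_ : [set x | _] = \bigcup_(i in [set: I]) A i); last first.
  by apply/seteqP; split => x [i]; exists i.
exact: countable_bigcupT_measurable.
Qed.

Lemma measurable_forall (I : countType) (A : I -> set T) :
  (forall i, measurable (A i)) -> measurable [set x | forall i, A i x].
Proof.
move=> mA; rewrite -[X in measurable X]setCK; apply: measurableC.
rewrite (_ : ~` _ = [set x | exists i, (~` A i) x]); last first.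
  by apply/seteqP; split => x /existsNP.
by apply: measurable_exists => i; exact: measurableC.
Qed.

Lemma measurable_imply (Q : Prop) (A : set T) :
  (Q -> measurable A) -> measurable [set x | Q -> A x].
Proof.
have [q mA|nq _] := pselect Q.
  by rewrite (_ : [set x | _] = A); [exact: mA|apply/seteqP; split => x /=; auto].
by rewrite (_ : [set x | _] = setT)//; apply/seteqP; split => x // _ /nq.
Qed.

Lemma measurable_set_lt (R : realType) (f g : T -> R) :
  measurable_fun setT f -> measurable_fun setT g ->
  measurable [set x | f x < g x].
Proof.
move=> mf mg; have /(_ measurableT [set true]) := measurable_fun_ltr mf mg.
by rewrite setTI; exact.
Qed.

Lemma measurable_set_le (R : realType) (f g : T -> R) :
  measurable_fun setT f -> measurable_fun setT g ->
  measurable [set x | f x <= g x].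
Proof.
move=> mf mg; have /(_ measurableT [set true]) := measurable_fun_ler mf mg.
by rewrite setTI; exact.
Qed.

End CountableQuantifiers.

Lemma borel_measurable_preimage d (T : measurableType d) (U : ptopologicalType)
    (f : T -> borel U) :
  measurable_fun setT f -> forall A : set U, open A -> measurable (f @^-1` A).
Proof.
by move=> mf A oA; rewrite -[X in measurable X]setTI; apply: mf => //;
  exact: sub_sigma_algebra.
Qed.

Section UniqueGeodesics.
Context {R : realType} (M : completePMetricType R).
Implicit Types (p q x y z m : M) (r s t e : R).

Lemma separable_sequence : separable M ->
  exists a : nat -> M, forall x e, 0 < e -> exists n, mdist x (a n) < e.
Proof.
move=> [D /countable_injP[f finj] dD].
(* Invert an injection of [D] into the natural numbers; [point] is used outside its range. *)
exists (fun n => xget point [set x | D x /\ f x = n]) => x e e0.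
have [||y [/= xy Dy]] := dD [set y | mdist x y < e].
- by exists x; rewrite /= mdistxx.
- rewrite openE => z /= xz; apply/nbhs_mdist; exists (e - mdist x z).
    by rewrite subr_gt0.
  by move=> y /= zy; have := metric_triangle x z y; lra.
exists (f y); case: xgetP => [z _ [Dz fz]|/(_ y)]; last by case.
by rewrite (finj z y)// inE.
Qed.

Hypothesis lenM : length_space M.
Hypothesis properM : forall p r, compact (cball p r).
Variable a : nat -> M.
Hypothesis dense_a : forall x e, 0 < e -> exists n, mdist x (a n) < e.

Lemma dense_between t p q m e e' : between0 t p q m -> 0 < e -> 0 < e' ->
  exists2 n, between t e p q (a n) & mdist m (a n) < e'.
Proof.
move=> [pm mq] e0 e'0; have [|n mn] := @dense_a m (Num.min e e').
  by rewrite lt_min e0.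
move: mn; rewrite lt_min => /andP[mn mn']; exists n => //; split.
  by have := metric_triangle p m (a n); lra.
by have := metric_triangle (a n) m q; rewrite (metric_sym (a n) m); lra.
Qed.

Lemma minimizing_between p q gamma t : minimizing_geodesic p q gamma ->
  0 <= t <= 1 -> between0 t p q (gamma t).
Proof.
move=> [g0 g1 gE] /andP[t0 t1]; split.
  by rewrite -{1}g0 gE// subr0.
by rewrite -{1}g1 gE.
Qed.

(** The sets of approximate points of parameter [t] shrink to at most one point, for
    every rational [t]. All quantifiers range over countable sets, and only distances
    between [p], [q] and the terms of the dense sequence are involved. *)
Definition close_between p q := forall (t : rat) (k : nat), (0 < t < 1) -> exists l : nat,
  forall i j, between (ratr t) l.+1%:R^-1 p q (a i) ->
    between (ratr t) l.+1%:R^-1 p q (a j) -> mdist (a i) (a j) <= k.+1%:R^-1.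

Lemma between_le t e e' p q : e <= e' -> between t e p q `<=` between t e' p q.
Proof. by move=> ee m [pm mq]; split; lra. Qed.

Lemma ratr_in01 (t : rat) : (0 < (ratr t : R) < 1) = (0 < t < 1).
Proof. by rewrite ltr0q -(ltr_rat R t 1) rmorph1. Qed.

Lemma exists_natSinv_lt e : 0 < e -> exists k : nat, k.+1%:R^-1 < e.
Proof.
by move=> e0; have [k _ /(_ k (leqnn k))] := near_infty_natSinv_lt (PosNum e0); exists k.
Qed.

(** If the geodesic is unique then it passes through every point of [between0], which
    is thus a singleton, and [between_cluster] makes the approximate sets shrink to it.
    Conversely two minimizing geodesics agree at rational parameters, hence everywhere
    by continuity. *)
Lemma exists_unique_geodesicP p q :
  (exists gamma, unique_minimizing_geodesic p q gamma) <-> close_between p q.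
Proof.
split=> [[gamma [gm gu]] t k t01|cb].
  have t01R : 0 < (ratr t : R) < 1 by rewrite ratr_in01 t01.
  have t01R' : 0 <= (ratr t : R) <= 1 by lra.
  set e := k.+1%:R^-1; have e0 : 0 < e :> R by rewrite invr_gt0.
  pose m := gamma (ratr t).
  have [e' e'0 bm] : exists2 e', 0 < e' & forall x, between (ratr t) e' p q x ->
      mdist m x < e / 2.
    apply: contrapT => nbm.
    have [||x [xb]] := @between_cluster _ _ properM (ratr t) p q [set x | e / 2 <= mdist m x].
    - move=> x clx; rewrite /=; apply/ler_addgt0Pl => r r0.
      have [y [/= my xy]] := clx _ (nbhs_ballm x r0).
      by have := metric_triangle m x y; lra.
    - move=> r r0; apply/set0P/eqP => b0; apply: nbm; exists r => // x xb.
      rewrite ltNge; apply/negP => mx.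
      have : (between (ratr t) r p q `&` [set x | e / 2 <= mdist m x]) x by split.
      by rewrite b0.
    have [g' g'm g't] := geodesic_through lenM properM t01R xb.
    by rewrite /m -(gu _ g'm _ t01R') g't /= mdistxx; lra.
  have [l le] := exists_natSinv_lt e'0; exists l => i j bi bj.
  have := bm _ (between_le (ltW le) bi); have := bm _ (between_le (ltW le) bj).
  by have := metric_triangle (a i) m (a j); rewrite (metric_sym (a i) m); lra.
have [h gm] : exists h, minimizing_geodesic p q h.
  by exists (geodesic p q); exact: geodesic_minimizing.
exists h; split=> // g g'm.
have ghr (t : rat) : 0 < t < 1 -> g (ratr t) = h (ratr t).
  move=> t01; have t01R : 0 <= (ratr t : R) <= 1.
    by move: t01; rewrite -ratr_in01 => /andP[/ltW-> /ltW].
  apply: mdist_positivity; apply/eqP; rewrite eq_le mdist_ge0 andbT.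
  apply/ler_addgt0Pl => e e0; have e3 : 0 < e / 3 by rewrite divr_gt0.
  have [k ke] := exists_natSinv_lt e3; have [l cl] := cb t k t01.
  have l0 : 0 < l.+1%:R^-1 :> R by rewrite invr_gt0.
  have [i bi gi] := dense_between (minimizing_between g'm t01R) l0 e3.
  have [j bj hj] := dense_between (minimizing_between gm t01R) l0 e3.
  have := le_lt_trans (cl i j bi bj) ke.
  have := metric_triangle (g (ratr t)) (a i) (h (ratr t)).
  have := metric_triangle (a i) (a j) (h (ratr t)).
  by rewrite (metric_sym (a j) (h _)); lra.
suff ght (t : R) : 0 <= t <= 1 -> g t = h t by exact: ght.
move=> t01; apply: mdist_positivity; apply/eqP; rewrite eq_le mdist_ge0 andbT.
apply/ler_addgt0Pl => e e0.
have d0 := mdist_ge0 p q; set D := mdist p q in d0.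
have De : 0 < D + 1 by lra.
(* Both geodesics are [D]-Lipschitz, so that a rational within [eta] of [t] is
   enough; [D + 1] is used because [D] may vanish. *)
pose eta := e / (2 * (D + 1)); have eta0 : 0 < eta by rewrite divr_gt0// mulr_gt0.
have etaE : 2 * (eta * (D + 1)) = e.
  by rewrite /eta invfM; field; lra.
clearbody eta; have : Num.max 0 (t - eta) < Num.min 1 (t + eta).
  by rewrite gt_max !lt_min ltr01 /=; apply/and3P; split; lra.
move=> /rat_in_itvoo[r]; rewrite in_itv/= gt_max lt_min.
move=> /andP[/andP[r0 rt] /andP[r1 tr]].
have r01 : 0 < r < 1 by rewrite -ratr_in01 r0.
have lip f : minimizing_geodesic p q f -> mdist (f t) (f (ratr r)) <= eta * D.
  move=> [_ _ fE]; have [tr'|rt'] := leP t (ratr r).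
    by rewrite fE//; [rewrite -/D; nra|lra|lra].
  by rewrite metric_sym fE//; [rewrite -/D; nra|lra|lra|lra].
have := lip _ gm; have := lip _ g'm.
have := metric_triangle (g t) (g (ratr r)) (h t).
rewrite ghr// (metric_sym (h (ratr r)) (h t)); lra.
Qed.

(** When the minimizing geodesic is unique, the approximate midpoints converge to its
    midpoint, so that the distance from the center to [z] can be read off them. *)
Lemma geodesic_ballP p q z : geodesic_ball p q z <->
  close_between p q /\ forall k : nat, exists i,
    between 2^-1 k.+1%:R^-1 p q (a i) /\ mdist (a i) z < mdist p q / 2 + k.+1%:R^-1.
Proof.
have h01 : 0 <= (2^-1 : R) <= 1 by lra.
split=> [[gamma gu gz]|[cb bz]].
  split=> [|k]; first by apply/exists_unique_geodesicP; exists gamma.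
  have : 0 < k.+1%:R^-1 :> R by rewrite invr_gt0.
  move: (k.+1%:R^-1) => e e0.
  have [i bi gi] := dense_between (minimizing_between gu.1 h01) e0 e0.
  exists i; split => //.
  have := metric_triangle (a i) (gamma 2^-1) z; rewrite (metric_sym (a i) (gamma _)); lra.
have [gamma gu] := (exists_unique_geodesicP p q).2 cb; exists gamma => //.
apply/ler_addgt0Pl => e e0; have e3 : 0 < e / 3 by rewrite divr_gt0.
have [k ke] := exists_natSinv_lt e3.
have [|l cl] := cb 2^-1 k; first by [].
have l0 : 0 < l.+1%:R^-1 :> R by rewrite invr_gt0.
have rE : ratr 2^-1 = 2^-1 :> R by rewrite fmorphV rmorph_nat.
rewrite rE in cl.
have [j bj gj] := dense_between (minimizing_between gu.1 h01) l0 e3.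
have [i [bi iz]] := bz (maxn k l).
have lk (n : nat) : (n <= maxn k l)%N -> (maxn k l).+1%:R^-1 <= n.+1%:R^-1 :> R.
  by move=> nk; rewrite lef_pV2 ?posrE// ler_nat ltnS.
have := le_lt_trans (cl i j (between_le (lk l (leq_maxr _ _)) bi) bj) ke.
have : mdist (a i) z < mdist p q / 2 + e / 3.
  by rewrite (lt_trans iz)// ltrD2l (le_lt_trans (lk k (leq_maxl _ _)) ke).
have := metric_triangle (gamma 2^-1) (a j) z.
have := metric_triangle (a j) (a i) z.
by rewrite (metric_sym (a j) (a i)); lra.
Qed.

(** The distance is continuous, and [mdist x y < r] if and only if
    [mdist x (a n) + mdist y (a n) < r] for some [n], which reduces the measurability in
    two variables to the separate one. *)
Lemma measurable_mdist d (T : measurableType d) (f g : T -> borel M) :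
  measurable_fun setT f -> measurable_fun setT g ->
  measurable_fun setT (fun w => mdist (f w : M) (g w)).
Proof.
move=> mf mg.
have mfa (h : T -> borel M) n : measurable_fun setT h ->
    measurable_fun setT (fun w => mdist (h w : M) (a n)).
  move=> mh _; apply: (measurability _ (RGenInftyO.measurableE R)) => //.
  move=> _ [_ [r ->] <-]; rewrite setTI.
  have -> : (fun w => mdist (h w : M) (a n)) @^-1` `]-oo, r[ =
      h @^-1` [set x : M | mdist x (a n) < r].
    by apply/seteqP; split => w /=; rewrite in_itv.
  apply: borel_measurable_preimage => //.
  rewrite openE => z /= xz; apply/nbhs_mdist; exists (r - mdist z (a n)).
    by rewrite subr_gt0.
  move=> y /= zy; have := metric_triangle y z (a n); rewrite (metric_sym y z); lra.
move=> _; apply: (measurability _ (RGenInftyO.measurableE R)) => //.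
move=> _ [_ [r ->] <-]; rewrite setTI.
have -> : (fun w => mdist (f w : M) (g w)) @^-1` `]-oo, r[ =
    [set w | exists n, mdist (f w : M) (a n) + mdist (g w : M) (a n) < r].
  apply/seteqP; split => w /=; rewrite in_itv/=.
    move=> fg; have [|n fn] := @dense_a (f w) ((r - mdist (f w : M) (g w)) / 2).
      by rewrite divr_gt0// subr_gt0.
    exists n; have := metric_triangle (g w : M) (f w) (a n).
    by rewrite (metric_sym (g w) (f w)); lra.
  move=> [n]; have := metric_triangle (f w : M) (a n) (g w).
  by rewrite (metric_sym (a n) (g w)); lra.
apply: measurable_exists => n; apply: measurable_set_lt; last exact: measurable_cst.
by apply: measurable_funD; exact: mfa.
Qed.

(** The ball [B_pq] depends measurably on [(p, q)]: uniqueness of the geodesic and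
    membership are countable combinations of inequalities between distances. *)
Lemma measurable_geodesic_ball d (T : measurableType d) (f g h : T -> borel M) :
  measurable_fun setT f -> measurable_fun setT g -> measurable_fun setT h ->
  measurable [set w | geodesic_ball (f w : M) (g w) (h w)].
Proof.
move=> mf mg mh.
have mb t e n : measurable [set w | between t e (f w : M) (g w) (a n)].
  apply: measurableI; apply: measurable_set_lt;
    repeat (apply: measurable_mdist || apply: measurable_funD ||
      apply: measurable_funM || exact: measurable_cst) => //.
rewrite (_ : [set w | _] = [set w | close_between (f w) (g w)] `&`
    [set w | forall k : nat, exists i, between 2^-1 k.+1%:R^-1 (f w : M) (g w) (a i) /\
      mdist (a i : M) (h w) < mdist (f w : M) (g w) / 2 + k.+1%:R^-1]); last first.
  by apply/seteqP; split => w /geodesic_ballP.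
apply: measurableI; last first.
  apply: measurable_forall => k; apply: measurable_exists => i.
  apply: measurableI; first exact: mb.
  apply: measurable_set_lt;
    repeat (apply: measurable_mdist || apply: measurable_funD ||
      apply: measurable_funM || exact: measurable_cst) => //.
apply: measurable_forall => t; apply: measurable_forall => k.
apply: measurable_imply => _; apply: measurable_exists => l.
apply: measurable_forall => i; apply: measurable_forall => j.
rewrite [X in measurable X](_ : _ = ~` ([set w | between (ratr t) l.+1%:R^-1 (f w : M) (g w) (a i)]
  `&` [set w | between (ratr t) l.+1%:R^-1 (f w : M) (g w) (a j)]) `|`
  [set w | mdist (a i : M) (a j) <= k.+1%:R^-1]).
  apply: measurableU.
    by apply: measurableC; apply: measurableI; exact: mb.
  by apply: measurable_set_le; exact: measurable_cst.
apply/seteqP; split => w /=.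
  move=> H; have [[bi bj]|nb] := pselect (between (ratr t) l.+1%:R^-1 (f w : M) (g w) (a i)
    /\ between (ratr t) l.+1%:R^-1 (f w : M) (g w) (a j)).
    by right; exact: H.
  by left.
by move=> [nb bi bj|//]; exfalso; exact: nb.
Qed.

End UniqueGeodesics.

(** * Riemannian distances are length distances *)

Section RiemannianLength.
Context {R : realType} (n : nat) (M : completePMetricType R).
Variable g : orientedRiemannian R n M.
Notation mu := (@lebesgue_measure R).

Section ChartCurve.
Variables (i : chart g) (c : R -> 'rV[R]_n).
Hypothesis c_derivable : forall t, derivable c t 1.
Hypothesis Dc_continuous : continuous (fun t => 'D_1 c t).
Hypothesis c_img : forall t, 0 <= t <= 1 -> (phi i @` dom i) (c t).

Let c_diff t : differentiable c t. Proof. exact/derivable1_diffP. Qed.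

Lemma speed_continuous t : 0 <= t <= 1 -> {for t, continuous (speed i c)}.
Proof.
move=> t01; rewrite /speed.
apply: (@continuous_comp _ _ _ (fun t => ('D_1 c t *m gram i (c t) *m ('D_1 c t)^T) 0 0)
  Num.sqrt); last exact: sqrt_continuous.
have -> : (fun t => ('D_1 c t *m gram i (c t) *m ('D_1 c t)^T) 0 0) =
    (fun t => \sum_k (\sum_j 'D_1 c t 0 j * gram i (c t) j k) * 'D_1 c t 0 k).
  by apply/funext => x; rewrite mxE; apply: eq_bigr => k _; rewrite !mxE.
have Dk k : 'D_1 c x 0 k @[x --> t] --> 'D_1 c t 0 k.
  apply: (continuous_comp (f := fun t => 'D_1 c t) (g := fun v : 'rV[R]_n => v 0 k)).
    exact: Dc_continuous.
  exact: coord_continuous.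
have Gjk j k : gram i (c x) j k @[x --> t] --> gram i (c t) j k.
  apply: (continuous_comp (f := c) (g := fun x => gram i x j k)).
    exact: differentiable_continuous.
  have [Gc _] := gram_smooth i j k 0%N.
  exact: Gc _ (c_img t01).
apply: cvg_big => [|k _]; first exact: add_continuous.
apply: cvgM; last exact: Dk.
by apply: cvg_big => [|j _]; [exact: add_continuous|exact: cvgM].
Qed.

Lemma speed_within a b : 0 <= a -> b <= 1 -> {within `[a, b], continuous (speed i c)}.
Proof.
move=> a0 b1; apply: continuous_in_subspaceT => t; rewrite inE/= in_itv/= => /andP[at_ tb].
by apply: speed_continuous; apply/andP; split; [exact: le_trans at_|exact: le_trans tb _].
Qed.

Lemma speed_integrable a b : 0 <= a -> b <= 1 ->
  mu.-integrable `[a, b] (EFin \o speed i c).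
Proof.
move=> a0 b1; apply: continuous_compact_integrable; first exact: segment_compact.
exact: speed_within.
Qed.

(** An affine change of parameter turns the arc over [[a, b]] into an admissible curve
    over [[0, 1]] of the same length. *)
Lemma mdist_arc (dM : riemannian_distance g) a b : 0 <= a -> a <= b -> b <= 1 ->
  mdist (psi i (c a)) (psi i (c b)) <= (\int[mu]_(t in `[a, b]) speed i c t)%R.
Proof.
move=> a0; rewrite le_eqVlt => /predU1P[<- _|ab b1].
  by rewrite mdistxx; apply: Rintegral_ge0 => t _; exact: sqrtr_ge0.
pose k := b - a; have k0 : 0 < k by rewrite subr_gt0.
pose h (s : R) := a + s * k; pose c' := c \o h.
have hD (s : R) : is_derive s (1 : R) h k.
  have -> : h = (cst a : R -> R) + k *: (@idfun R).
    by apply/funext => x; rewrite /h /= mulrC.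
  by apply: is_derive_eq; rewrite add0r /GRing.scale/= mulr1.
have dh (s : R) : differentiable h s by apply/derivable1_diffP; exact: (@ex_derive _ _ _ _ _ _ _ (hD s)).
have dhE : derive1 h = cst k by apply/funext => s; rewrite derive1E derive_val.
have c'D (s : R) : 'D_1 c' s = k *: 'D_1 c (h s).
  have dc' : differentiable c' s by exact: differentiable_comp.
  rewrite deriveE// /c' diff_comp//= -[in 'd h s 1]deriveE// derive_val.
  by rewrite -[in LHS](mulr1 k) -[k * 1]/(k *: (1 : R^o)) linearZ/= -deriveE.
have h0 : h 0 = a by rewrite /h mul0r addr0.
have h1 : h 1 = b by rewrite /h mul1r /k addrC subrK.
have h01 (s : R) : 0 <= s <= 1 -> 0 <= h s <= 1.
  by move=> /andP[s0 s1]; rewrite /h; move: a0 k0 b1; rewrite /k => *; nra.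
have cl : curve_length g (psi i (c' 0)) (psi i (c' 1))
    (\int[mu]_(t in `[0%R, 1%R]) (speed i c' t)%:E)%E.
  apply: curve_length_chart.
  - by move=> s; apply/derivable1_diffP; exact: differentiable_comp.
  - under eq_fun do rewrite c'D.
    move=> s; apply: cvgZr.
    apply: (continuous_comp (f := h) (g := fun t => 'D_1 c t)).
      exact: differentiable_continuous.
    exact: Dc_continuous.
  - by move=> s s01; apply: c_img; exact: h01.
have : ((mdist (psi i (c a)) (psi i (c b)))%:E <=
    \int[mu]_(t in `[0%R, 1%R]) (speed i c' t)%:E)%E.
  by rewrite dM -{1}h0 -{1}h1; exact: ereal_inf_lbound.
have -> : (\int[mu]_(t in `[0%R, 1%R]) (speed i c' t)%:E)%E =
    (\int[mu]_(t in `[a, b]) (speed i c t)%:E)%E.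
  rewrite -[in RHS]h0 -[in RHS]h1 (@integration_by_substitution_increasing _ h)//.
  - apply: eq_integral => s _; congr EFin.
    rewrite /= -[RHS]/(speed i c (h s) * derive1 h s) derive1E derive_val /speed c'D.
    have -> : (k *: 'D_1 c (h s))^T = k *: ('D_1 c (h s))^T by rewrite linearZ.
    rewrite -scalemxAr -!scalemxAl scalerA mxE -expr2 sqrtrM ?sqr_ge0//.
    by rewrite sqrtr_sqr ger0_norm ?ltW// mulrC.
  - by move=> x y _ _ xy; rewrite /h ltrD2l ltr_pM2r.
  - by move=> x _; rewrite dhE; exact: cst_continuous.
  - by rewrite dhE; exact: is_cvg_cst.
  - by rewrite dhE; exact: is_cvg_cst.
  - split.
    + by move=> x _; apply/derivable1_diffP.
    + by apply: cvg_at_right_filter; exact: differentiable_continuous.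
    + by apply: cvg_at_left_filter; exact: differentiable_continuous.
  - by rewrite h0 h1; exact: speed_within.
rewrite /Rintegral -lee_fin fineK//; apply: integrable_fin_num => //.
exact: speed_integrable.
Qed.

End ChartCurve.

(** Cut an almost minimizing curve at the point where its arc length is [s], which
    exists by the intermediate value theorem in the chart where that happens. *)
Lemma riemannian_length_space : riemannian_distance g -> length_space M.
Proof.
move=> dM.
have dlL p q L : curve_length g p q L -> ((mdist p q)%:E <= L)%E.
  by move=> c; rewrite dM; exact: ereal_inf_lbound.
(* The induction on the curve keeps track of the exact length that is left after the
   cut. *)
have key p q L : curve_length g p q L -> forall s, 0 <= s -> (s%:E <= L)%E ->
    (L < +oo)%E -> exists2 m, mdist p m <= s & ((mdist m q + s)%:E <= L)%E.
  elim=> [i c cD Dc cimg s s0|p' q' r' L1 L2 c1 IH1 c2 IH2 s s0].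
    have dint a b := speed_integrable cD Dc cimg (a := a) (b := b).
    have -> : (\int[mu]_(t in `[0%R, 1%R]) (speed i c t)%:E)%E =
       ((\int[mu]_(t in `[0, 1]) speed i c t)%R)%:E.
      by rewrite /Rintegral fineK//; apply: integrable_fin_num => //; exact: dint.
    rewrite lee_fin => sL _.
    set l := fun x => parameterized_integral mu 0 x (speed i c).
    have l0 : l 0 = 0 by rewrite /l /parameterized_integral set_itv1 Rintegral_set1.
    have [|t] := @IVT R l 0 1 s ler01
      (parameterized_integral_continuous ler01 (dint _ _ (lexx _) (lexx _))).
      rewrite l0; move: sL; rewrite -[X in _ <= X]/(l 1) => sL.
      by rewrite ge_min s0 le_max sL orbT.
    rewrite in_itv/= => /andP[t0 t1] lt; exists (psi i (c t)).
      by rewrite -lt; exact: (mdist_arc cD Dc cimg dM (lexx _) t0 t1).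
    rewrite lee_fin (le_trans (lerD (mdist_arc cD Dc cimg dM t0 t1 (lexx _)) (lexx s)))//.
    rewrite -lt /l /parameterized_integral.
    rewrite -(@Rintegral_itv_obnd_cbnd _ t (BRight 1)).
      rewrite -(@Rintegral_itvB _ (speed i c) (BLeft 0) (BRight 1) t) ?bnd_simp//.
        by rewrite subrK.
      exact: dint.
    apply: integrableS (dint _ _ (lexx 0) (lexx 1)) => //.
    by apply: subset_itvr; rewrite bnd_simp.
  have := dlL _ _ _ c1; have := dlL _ _ _ c2.
  case: L1 c1 IH1 => [x| |]//; case: L2 c2 IH2 => [y| |]// c2 IH2 c1 IH1.
  rewrite !lee_fin => qr pq sL _.
  have [sx|xs] := leP s x.
    have [m pm mq] := IH1 s s0 sx (ltry _).
    exists m => //; move: mq; rewrite -EFinD !lee_fin.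
    by have := metric_triangle m q' r'; lra.
  have sx0 : 0 <= s - x by rewrite subr_ge0 ltW.
  have sxy : s - x <= y by rewrite lerBlDl.
  have [m qm mr] := IH2 _ sx0 sxy (ltry _).
  exists m; first by have := metric_triangle p' q' m; lra.
  by move: mr; rewrite -EFinD !lee_fin; lra.
move=> p q s e /andP[s0 sd] e0.
have : (ereal_inf [set L | curve_length g p q L] < (mdist p q + e)%:E)%E.
  by rewrite -dM lte_fin ltrDl.
move=> /ereal_inf_lt[L /= cL Le].
have sL : (s%:E <= L)%E by rewrite (le_trans _ (dlL _ _ _ cL))// lee_fin.
have [m pm mq] := key _ _ _ cL s s0 sL (lt_trans Le (ltry _)).
exists m => //; have := le_lt_trans mq Le; rewrite lte_fin; lra.
Qed.

(** The inverse of a chart maps a small closed ball of coordinates to a compact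
    neighbourhood. *)
Lemma riemannian_locally_compact x : exists2 e, 0 < e & compact (cball (x : M) e).
Proof.
have [i ix] := dom_cover g x.
set u := phi i x.
have Ou : nbhs u (phi i @` dom i) by apply: open_nbhs_nbhs; split; [exact: img_open|exists x].
move: Ou => /nbhs_ballP[r /= r0 rO].
pose K := [set v : 'rV[R]_n | `|u - v| <= r / 2].
have r2 : 0 < r / 2 by rewrite divr_gt0.
have KO : K `<=` phi i @` dom i.
  move=> v Kv; apply: rO; rewrite -ball_normE /=; apply: (le_lt_trans Kv); lra.
have cK : compact K.
  apply: bounded_closed_compact.
    exists (`|u| + r / 2); split; first exact: num_real.
    move=> y yr v Kv; apply: ltW; apply: le_lt_trans yr.
    rewrite -[v](subKr u) (le_trans (ler_normB _ _))// lerD2l.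
    exact: Kv.
  exact: closed_closed_ball_.
have cpsi : compact (psi i @` K).
  apply: continuous_compact => //; apply: continuous_in_subspaceT => v.
  by rewrite inE => /KO; exact: psi_continuous.
have [e e0 eK] : exists2 e, 0 < e & [set y | mdist x y < e] `<=` psi i @` K.
  apply/nbhs_mdist.
  have uK : nbhs u K.
    by apply/nbhs_ballP; exists (r / 2) => // v; rewrite -ball_normE /= => /ltW.
  have dx : nbhs x (dom i) by apply: open_nbhs_nbhs; split; [exact: dom_open|].
  have dK : nbhs x (dom i `&` phi i @^-1` K) by exact: filterI dx (phi_continuous ix uK).
  apply: filterS dK => y [iy Ky]; exists (phi i y) => //; exact: phiK.
exists (e / 2); first by rewrite divr_gt0.
apply: subclosed_compact cpsi _; first exact: closed_cball.
by move=> y; rewrite /cball/= => xy; apply: eK => /=; lra.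
Qed.

End RiemannianLength.

(** * Independence *)

Section Independence.
Context d (Omega : measurableType d) (R : realType) (P : probability Omega R).

Definition independent_sets (F G : set (set Omega)) : Prop :=
  forall A B, F A -> G B -> P (A `&` B) = (P A * P B)%E.

Lemma independent_setsC F G : independent_sets F G -> independent_sets G F.
Proof. by move=> FG A B GA FB; rewrite setIC FG// muleC. Qed.

(** Both sides are finite measures of [A], so that equality extends from a
    pi-system to the sigma-algebra it generates. *)
Lemma independent_sigma_left (F G : set (set Omega)) :
  F `<=` measurable -> G `<=` measurable -> setI_closed F ->
  independent_sets F G -> independent_sets <<s F >> G.
Proof.
move=> Fm Gm FI FG A B FA GB.
have mB := Gm _ GB.
have mA : measurable A by apply: (smallest_sub (@sigma_algebra_measurable _ Omega)) FA.
have PB : P B = (fine (P B))%:E by rewrite fineK ?fin_num_measure.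
have fB0 : 0 <= fine (P B) by rewrite fine_ge0.
pose F' := F `|` [set setT].
have F'I : setI_closed F'.
  move=> C D [FC|->] [FD|->]; rewrite ?setIT ?setTI; last by right.
  - by left; exact: FI.
  - by left.
  - by left.
have F'm : F' `<=` measurable by move=> C [/Fm//|->]; exact: measurableT.
have F'A : <<s F' >> A by apply: sub_sigma_algebra2 FA; left.
pose r : {nonneg R} := NngNum fB0; have rE : r%:num%:E = P B by rewrite PB.
rewrite -[LHS]/(mrestr P mB A) -rE muleC -[RHS]/(mscale r P A).
apply: (g_sigma_algebra_measure_unique F' F'm (fun=> setT)) => //.
- by move=> _; right.
- by apply/seteqP; split => // x _; exists 0%N.
- move=> C F'C; rewrite -[LHS]/(P (C `&` B)) -[RHS]/(r%:num%:E * P C)%E rE.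
  by case: F'C => [FC|->]; [rewrite FG// muleC|rewrite setTI probability_setT mule1].
- by move=> _; rewrite -[X in (X < _)%E]/(P (setT `&` B)) setTI ltey_eq fin_num_measure.
Qed.

Lemma independent_sigma (F G : set (set Omega)) :
  F `<=` measurable -> G `<=` measurable -> setI_closed F -> setI_closed G ->
  independent_sets F G -> independent_sets <<s F >> <<s G >>.
Proof.
move=> Fm Gm FI GI FG.
apply: independent_sigma_left => //.
  exact: (smallest_sub (@sigma_algebra_measurable _ Omega)).
apply: independent_setsC; apply: independent_sigma_left => //.
exact: independent_setsC.
Qed.

Definition sigma_group (I : choiceType) (F : I -> set (set Omega)) (s : seq I) :=
  \bigcup_(i in [set` s]) F i.

(** Finite intersections of events of the family form a pi-system; the product rule
    for the concatenation of the two sequences gives independence. *)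
Lemma mutually_independent_groups (I : choiceType) (F : I -> set (set Omega)) (s t : seq I) :
  (forall i, F i `<=` measurable) -> (forall i, setI_closed (F i)) ->
  (forall i, F i setT) -> mutually_independent P F -> uniq (s ++ t) ->
  independent_sets <<s sigma_group F s >> <<s sigma_group F t >>.
Proof.
move=> Fm FI FT indF ust.
pose pi (u : seq I) := [set B | exists2 A : I -> set Omega, (forall i, i \in u -> F i (A i)) &
  B = \bigcap_(i in [set` u]) A i].
have pi_sub u : <<s sigma_group F u >> `<=` <<s pi u >>.
  apply: smallest_sub; first exact: smallest_sigma_algebra.
  move=> A [i /= iu FA]; apply: sub_sigma_algebra; exists (fun j => if j == i then A else setT).
    by move=> j ju; case: eqP => [->|].
  apply/seteqP; split => x; first by move=> Ax j ju; case: eqP.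
  by move=> /(_ i iu); rewrite eqxx.
have piI u : setI_closed (pi u).
  move=> _ _ [A FA ->] [B FB ->]; exists (fun i => A i `&` B i).
    by move=> i iu; apply: FI; [exact: FA|exact: FB].
  by rewrite bigcapI.
have pim u : pi u `<=` measurable.
  move=> _ [A FA ->]; rewrite bigcap_seq big_seq.
  by apply: bigsetI_measurable => i /FA; exact: Fm.
move=> A B /pi_sub As /pi_sub Bt.
apply: independent_sigma As Bt; [exact: pim..|exact: piI|exact: piI|].
move=> _ _ [A' FA ->] [B' FB ->].
pose C i := if i \in s then A' i else B' i.
have Cs : \bigcap_(i in [set` s]) A' i = \bigcap_(i in [set` s]) C i.
  by apply: eq_bigcapr => i /= is_; rewrite /C is_.
have us : uniq s by move: ust; rewrite cat_uniq => /and3P[].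
have ut : uniq t by move: ust; rewrite cat_uniq => /and3P[].
have tns i : i \in t -> i \notin s.
  by move: ust; rewrite cat_uniq => /and3P[_ /hasPn st _] /st.
have Ct : \bigcap_(i in [set` t]) B' i = \bigcap_(i in [set` t]) C i.
  by apply: eq_bigcapr => i /= /tns it; rewrite /C (negbTE it).
have FCs i : i \in s -> F i (C i) by move=> is_; rewrite /C is_; exact: FA.
have FCt i : i \in t -> F i (C i) by move=> it; rewrite /C (negbTE (tns _ it)); exact: FB.
rewrite Cs Ct -bigcap_setU.
have -> : [set` s] `|` [set` t] = [set` s ++ t].
  by apply/seteqP; split => i /=; rewrite mem_cat => /orP.
rewrite !indF// ?big_cat ?EFinM//.
by move=> i; rewrite mem_cat => /orP[/FCs|/FCt].
Qed.

Lemma mutually_independent_pair (I : choiceType) (F : I -> set (set Omega)) (i j : I) :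
  F i `<=` measurable -> F j `<=` measurable -> mutually_independent P F -> i != j ->
  independent_sets (F i) (F j).
Proof.
move=> Fi Fj indF ij A B FA FB.
have FAB k : k \in [:: i; j] -> F k (if k == i then A else B).
  rewrite !inE => /orP[/eqP->|/eqP->]; first by rewrite eqxx.
  by rewrite eq_sym (negbTE ij).
have uij : uniq [:: i; j] by rewrite /= inE ij.
have := indF _ _ uij FAB.
rewrite bigcap_seq !big_cons !big_nil setIT mulr1 EFinM eqxx eq_sym (negbTE ij).
by rewrite !fineK ?fin_num_measure//; [exact: Fj|exact: Fi].
Qed.

End Independence.

(** * Integrals of functions of independent random elements *)

Section IndependentIntegrals.
Context d (Omega : measurableType d) (R : realType) (P : probability Omega R).
Local Open Scope ereal_scope.

Lemma prob_bounded_integrable (f : Omega -> R) (c : R) :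
  measurable_fun setT f -> (forall w, `|f w| <= c)%R -> P.-integrable setT (EFin \o f).
Proof.
move=> mf fc; apply: measurable_bounded_integrable => //.
  by rewrite ltey_eq fin_num_measure.
exists c; split; first exact: num_real.
by move=> y cy w _; apply: ltW; exact: le_lt_trans (fc w) cy.
Qed.

Lemma same_law_integral d' (T : measurableType d') (Y Y' : Omega -> T) (F : T -> \bar R) :
  measurable_fun setT Y -> measurable_fun setT Y' -> same_law P Y Y' ->
  measurable_fun setT F -> (forall x, 0 <= F x) ->
  \int[P]_w F (Y w) = \int[P]_w F (Y' w).
Proof.
move=> mY mY' YY' mF F0.
rewrite -[LHS](@ge0_integral_pushforward _ _ _ _ _ _ mY P setT F)//.
rewrite -[RHS](@ge0_integral_pushforward _ _ _ _ _ _ mY' P setT F)//.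
by apply: eq_measure_integral => /= A mA _; exact: YY'.
Qed.

(** By independence the joint law of [(U, V)] is the product of the marginal laws;
    then apply Fubini. *)
Lemma independent_integral d1 d2 (T1 : measurableType d1) (T2 : measurableType d2)
    (U : Omega -> T1) (V : Omega -> T2) (F : T1 * T2 -> \bar R) :
  measurable_fun setT U -> measurable_fun setT V ->
  independent_sets P (sigma_of U) (sigma_of V) ->
  measurable_fun setT F -> (forall x, 0 <= F x) ->
  \int[P]_w F (U w, V w) = \int[P]_w \int[P]_w' F (U w, V w').
Proof.
move=> mU mV UV mF F0.
have mUV : measurable_fun setT (fun w => (U w, V w)) by exact: measurable_fun_pair.
pose U' : {mfun Omega >-> T1} := mfun_Sub (mem_set mU).
pose V' : {mfun Omega >-> T2} := mfun_Sub (mem_set mV).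
rewrite -[LHS](@ge0_integral_pushforward _ _ _ _ _ _ mUV P setT F)//.
transitivity (\int[distribution P U' \x distribution P V']_z F z).
  apply: eq_measure_integral => /= A mA _; apply/esym.
  apply: product_measure_unique => //= B C mB mC.
  rewrite /pushforward /distribution /pushforward /=.
  by apply: UV; [exists B|exists C]; rewrite ?setTI.
rewrite fubini_tonelli1// (@ge0_integral_distribution _ _ _ _ _ P U'); last 2 first.
- exact: measurable_fun_fubini_tonelli_F.
- by move=> x; apply: integral_ge0.
apply: eq_integral => w _; rewrite /= /fubini_F.
rewrite (@ge0_integral_distribution _ _ _ _ _ P V' (fun y => F (U w, y)))//.
by apply: measurableT_comp => //; exact: measurable_pair1.
Qed.

End IndependentIntegrals.

(** * Borel sets of row vectors *)

Section BorelRowVectors.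
Context {R : realType} (m : nat).

Definition rat_box (b : 'rV[rat]_m * rat) : set 'rV[R]_m :=
  [set y | forall i, `|y 0 i - ratr (b.1 0 i)| < ratr b.2].

Lemma open_rat_box (U : set 'rV[R]_m) x : open U -> U x ->
  exists2 b, rat_box b x & rat_box b `<=` U.
Proof.
move=> oU Ux; have /nbhs_ballP[e /= e0 eU] : nbhs x U by exact: open_nbhs_nbhs.
have [r] := rat_in_itvoo (divr_gt0 e0 (ltr0n R 2)); rewrite in_itv/= => /andP[r0 re].
have /choice[c xc] : forall i, exists c : rat, `|x 0 i - ratr c| < ratr r.
  move=> i; have [|c] := @rat_in_itvoo _ (x 0 i - ratr r) (x 0 i + ratr r); first lra.
  by rewrite in_itv/= => xc; exists c; rewrite distrC ltr_distl.
exists (\row_i c i, r) => [i|y yb]; first by rewrite mxE.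
apply: eU; split=> // i j; rewrite (ord1 i) /ball/=.
have := yb j; rewrite mxE /= distrC => yc; have := xc j.
by have := ler_distD (ratr (c j)) (x 0 j) (y 0 j); lra.
Qed.

Lemma measurable_coord (i : 'I_m) :
  measurable_fun setT (fun x : borel 'rV[R]_m => (x : 'rV[R]_m) 0 i).
Proof.
move=> _; apply: (measurability _ (RGenInftyO.measurableE R)) => //.
move=> _ [_ [r ->] <-]; rewrite setTI; apply: sub_sigma_algebra.
by apply: open_comp; [move=> x _; exact: coord_continuous|exact: interval_open].
Qed.

(** An open set is a union of rational boxes, of which there are countably many. *)
Lemma measurable_rowP d (T : measurableType d) (h : T -> borel 'rV[R]_m) :
  measurable_fun setT h <->
  forall i, measurable_fun setT (fun w => (h w : 'rV[R]_m) 0 i).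
Proof.
split=> [mh i|mh]; first exact: measurableT_comp (measurable_coord i) mh.
have oE : @measurable _ (borel 'rV[R]_m) = <<s @open 'rV[R]_m >> by [].
apply: (measurability _ oE) => _ [U oU <-].
rewrite setTI; have -> : h @^-1` U = [set w | exists b : 'rV[rat]_m * rat,
    rat_box b `<=` U /\ forall i : 'I_m,
      `|(h w : 'rV[R]_m) 0 i - ratr (b.1 0 i)| < ratr b.2].
  apply/seteqP; split => w /=.
    by move=> /(open_rat_box oU)[b bw bU]; exists b.
  by move=> [b [bU bw]]; exact: bU.
apply: measurable_exists => b; have [bU|nbU] := pselect (rat_box b `<=` U); last first.
  by rewrite (_ : (fun _ => _) = set0)//; apply/seteqP; split => w // [].
rewrite (_ : (fun _ => _) = [set w | forall i : 'I_m,
      `|(h w : 'rV[R]_m) 0 i - ratr (b.1 0 i)| < ratr b.2]); last first.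
  by apply/seteqP; split => w //= [].
apply: measurable_forall => i; apply: measurable_set_lt => //.
apply: measurableT_comp => //.
by apply: measurable_funB => //; exact: mh.
Qed.

Definition boxes : set (set 'rV[R]_m) :=
  [set C | exists2 B : 'I_m -> set R, (forall i, measurable (B i)) &
     C = [set x : 'rV[R]_m | forall i, B i (x 0 i)]].

Lemma boxes_setI : setI_closed boxes.
Proof.
move=> _ _ [B mB ->] [C mC ->]; exists (fun i => B i `&` C i).
  by move=> i; exact: measurableI.
by apply/seteqP; split => x /= => [[Bx Cx] i|BC]; [split|split=> i; case: (BC i)].
Qed.

Lemma boxes_measurable : boxes `<=` (measurable : set (set (borel 'rV[R]_m))).
Proof.
move=> _ [B mB ->]; apply: measurable_forall => i.
by rewrite -[X in measurable X]setTI; exact: measurable_coord.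
Qed.

Lemma borel_boxes (C : set (borel 'rV[R]_m)) : measurable C -> <<s boxes >> C.
Proof.
have mid : measurable_fun setT
    (id : g_sigma_algebraType boxes -> borel 'rV[R]_m).
  apply/measurable_rowP => i _ B mB; rewrite setTI; apply: sub_sigma_algebra.
  exists (fun j => if j == i then B else setT) => [j|]; first by case: eqP.
  apply/seteqP; split => x /= => [Bx j|/(_ i)]; last by rewrite eqxx.
  by case: eqP => [->|].
by move=> mC; have := mid measurableT C mC; rewrite setTI.
Qed.

Lemma borel_measure_unique (m1 m2 : {measure set (borel 'rV[R]_m) -> \bar R}) :
  (m1 setT < +oo)%E -> (forall B : 'I_m -> set R, (forall i, measurable (B i)) ->
    m1 [set x | forall i, B i ((x : 'rV[R]_m) 0 i)] =
    m2 [set x | forall i, B i ((x : 'rV[R]_m) 0 i)]) ->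
  forall C, measurable C -> m1 C = m2 C.
Proof.
move=> m1oo m12 C mC.
apply: (@g_sigma_algebra_measure_unique _ R (borel 'rV[R]_m) boxes boxes_measurable
  (fun=> setT)) => //.
- by move=> _; exists (fun=> setT) => //; apply/seteqP; split.
- by apply/seteqP; split => // x _; exists 0%N.
- exact: boxes_setI.
- by move=> _ [B mB ->]; exact: m12.
- exact: borel_boxes.
Qed.

End BorelRowVectors.

(** * The pick-freeze identity *)

Section PickFreeze.
Context {R : realType} (m : nat) d (Omega : measurableType d) (P : probability Omega R).
Variables (X X' : {RV P >-> borel 'rV[R]_m}) (nu : {set 'I_m}).
Hypothesis X_indep : mutually_independent P (fun i : 'I_m => sigma_of (component X i)).
Hypothesis X'_law : same_law P X' X.
Hypothesis X'_indep : mutually_independent P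
  (fun b : bool => if b then sigma_of X else sigma_of X').

Let rowT := borel 'rV[R]_m.

Definition mix_rows (x x' : 'rV[R]_m) : 'rV[R]_m :=
  \row_i (if i \in nu then x 0 i else x' 0 i).

Lemma mix_rowsA x x' x'' : mix_rows (mix_rows x x') x'' = mix_rows x x''.
Proof. by apply/rowP => i; rewrite !mxE; case: (i \in nu). Qed.

(** Only the coordinates of [f] in [nu] matter, so that the lemma applies when [f] is
    measurable for the sigma-algebra of these coordinates only. *)
Lemma measurable_mix_rows d' (T : measurableType d') (f g : T -> rowT) :
  (forall i, i \in nu -> measurable_fun setT (fun w => (f w : 'rV[R]_m) 0 i)) ->
  measurable_fun setT g ->
  measurable_fun setT (fun w => mix_rows (f w) (g w) : rowT).
Proof.
move=> mf mg; apply/measurable_rowP => i.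
under eq_fun do rewrite mxE.
by have [inu|_] := boolP (i \in nu); [exact: mf|exact: (measurable_rowP _).1 mg i].
Qed.

Lemma measurable_pick_freeze : measurable_fun setT (pick_freeze nu X X' : Omega -> rowT).
Proof.
apply: measurable_mix_rows; last exact: measurable_funPT.
by move=> i _; exact: (measurable_rowP _).1 (measurable_funPT X) i.
Qed.

Lemma X_X'_independent : independent_sets P (sigma_of X) (sigma_of X').
Proof.
by apply: (mutually_independent_pair (i := true) (j := false) _ _ X'_indep) => //;
  move=> _ [C mC <-]; exact: measurable_funPT.
Qed.

(** Replacing the coordinates outside [nu] by those of an independent copy does not
    change the law, as the coordinates are independent. *)
Lemma pick_freeze_law : same_law P (pick_freeze nu X X' : Omega -> rowT) (X : Omega -> rowT).
Proof.
pose Xnu : {mfun Omega >-> rowT} := mfun_Sub (mem_set measurable_pick_freeze).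
move=> C mC; rewrite -[LHS]/(distribution P Xnu C) -[RHS]/(distribution P X C).
apply: borel_measure_unique mC; first by rewrite ltey_eq fin_num_measure.
move=> B mB; rewrite /distribution /pushforward /=.
have mX (Y : {RV P >-> rowT}) i : sigma_of (component Y i) `<=` measurable.
  move=> _ [D mD <-].
  have := (measurable_rowP _).1 (measurable_funPT Y) i measurableT D mD.
  by rewrite setTI.
have prodE (s : {set 'I_m}) : P [set w | forall i, i \in s -> B i ((X w : 'rV[R]_m) 0 i)] =
    (\prod_(i in s) fine (P (component X i @^-1` B i)))%:E.
  have -> : [set w | forall i, i \in s -> B i ((X w : 'rV[R]_m) 0 i)] =
      \bigcap_(i in [set` enum s]) (component X i @^-1` B i).
    by apply/seteqP; split => w /= Bw i; have := Bw i; rewrite /= mem_enum.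
  rewrite X_indep ?enum_uniq// ?big_enum// => i _.
  by exists (B i) => //; rewrite setTI.
pose A1 := [set x : rowT | forall i, i \in nu -> B i ((x : 'rV[R]_m) 0 i)].
pose A2 := [set x : rowT | forall i, i \in ~: nu -> B i ((x : 'rV[R]_m) 0 i)].
have mA (s : {set 'I_m}) : measurable [set x : rowT | forall i, i \in s -> B i ((x : 'rV[R]_m) 0 i)].
  apply: measurable_forall => i; apply: measurable_imply => _.
  by rewrite -[X in measurable X]setTI; exact: measurable_coord.
transitivity (P (X @^-1` A1 `&` X' @^-1` A2)).
  congr (P _); apply/seteqP; split => w /=.
    by move=> Bw; split => i /= inu; have := Bw i; rewrite mxE ?inu//;
      move: inu; rewrite inE => /negbTE->.
  move=> [B1 B2] i; rewrite mxE; case: ifPn => inu; first exact: B1.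
  by apply: B2; rewrite inE.
rewrite X_X'_independent; last 2 first.
- by exists A1; rewrite ?setTI//; exact: mA.
- by exists A2; rewrite ?setTI//; exact: mA.
rewrite X'_law; last exact: mA.
rewrite [P (X @^-1` A1)]prodE [P (X @^-1` A2)]prodE -EFinM.
have := prodE [set: 'I_m]%SET; rewrite (_ : [set w | _] = X @^-1` [set x | forall i, B i ((x : 'rV[R]_m) 0 i)]).
  move=> E; apply/esym; apply: etrans E _; congr EFin; rewrite (big_setID nu) /= finset.setTI; congr (_ * _).
  by rewrite finset.setTD.
by apply/seteqP; split => w /= Bw i; [apply: Bw; rewrite inE|move=> _; exact: Bw].
Qed.

Local Open Scope ereal_scope.

Lemma pick_freeze_integral (F : rowT -> \bar R) :
  measurable_fun setT F -> (forall x, 0 <= F x) ->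
  \int[P]_w F (mix_rows (X w) (X' w)) = \int[P]_w F (X w).
Proof.
move=> mF F0; rewrite -(same_law_integral _ _ pick_freeze_law mF F0)//.
exact: measurable_pick_freeze.
Qed.

Lemma freeze_integral (F : rowT * rowT -> \bar R) :
  measurable_fun setT F -> (forall x, 0 <= F x) ->
  \int[P]_w F (X w, X' w) = \int[P]_w \int[P]_w' F (X w, X' w').
Proof.
move=> mF F0; apply: independent_integral => //; exact: X_X'_independent.
Qed.

Variable D : set rowT.
Hypothesis mD : measurable D.

(** The conditional probability of [D] given that the coordinates in [nu] are those
    of [x]. *)
Definition freeze_prob (x : 'rV[R]_m) : R := fine (P [set w | D (mix_rows x (X' w))]).

Let measurable_mix_cst x : measurable_fun setT (fun w => mix_rows x (X' w) : rowT).
Proof.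
apply: (@measurable_mix_rows _ _ (cst x) X') => [i _|]; first exact: measurable_cst.
exact: measurable_funPT.
Qed.

Let measurable_slice x : measurable [set w | D (mix_rows x (X' w))].
Proof.
by rewrite -[X in measurable X]setTI; exact: measurable_mix_cst.
Qed.

Lemma freeze_probE x :
  (freeze_prob x)%:E = \int[P]_w' (\1_D (mix_rows x (X' w')))%:E.
Proof.
rewrite /freeze_prob fineK ?fin_num_measure//.
rewrite (eq_integral (fun w => (\1_[set w | D (mix_rows x (X' w))] w)%:E)).
  by rewrite integral_indic// setIT.
by move=> w _; rewrite !indicE; congr (_%:R)%:E; apply/idP/idP; rewrite !inE.
Qed.

Lemma freeze_prob01 x : (0 <= freeze_prob x <= 1)%R.
Proof.
rewrite fine_ge0//= -lee_fin fineK ?fin_num_measure//; exact: probability_le1.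
Qed.

Lemma measurable_freeze_prob d' (T : measurableType d') (f : T -> rowT) :
  (forall i, i \in nu -> measurable_fun setT (fun w => (f w : 'rV[R]_m) 0%R i)) ->
  measurable_fun setT (fun w => freeze_prob (f w)).
Proof.
move=> mf; apply/measurable_EFinP.
have -> : EFin \o (fun w => freeze_prob (f w)) =
    fubini_F P (fun z : T * Omega => (\1_D (mix_rows (f z.1) (X' z.2)))%:E).
  by apply/funext => w; rewrite /= freeze_probE.
apply: measurable_fun_fubini_tonelli_F => [|z]; last by rewrite lee_fin.
have mm : measurable_fun setT (fun z : T * Omega => mix_rows (f z.1) (X' z.2) : rowT).
  apply: (@measurable_mix_rows _ _ (fun z : T * Omega => f z.1) (fun z => X' z.2)).
    by move=> i inu; exact: measurableT_comp (mf i inu) measurable_fst.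
  exact: measurableT_comp (measurable_funPT X') measurable_snd.
by apply/measurable_EFinP; exact: measurableT_comp (measurable_indic mD) mm.
Qed.

(** The events [X \in C] for which membership in [C] depends only on the coordinates
    in [nu] form a sigma-algebra. *)
Lemma sigma_coordsP A : sigma_coords X nu A ->
  exists C : set rowT, [/\ measurable C, A = X @^-1` C &
    forall x x', C (mix_rows x x') <-> C x].
Proof.
pose H := [set A : set Omega | exists C : set rowT, [/\ measurable C, A = X @^-1` C &
    forall x x', C (mix_rows x x') <-> C x]].
apply: (smallest_sub (X := H)); first split.
- by exists set0; split.
- move=> B [C [mC -> CC]]; exists (~` C); split; first exact: measurableC.
    by rewrite setTD.
  by move=> x x'; split => nC Cx; apply: nC; exact/(CC x x').
- move=> B /choice[C HC]; exists (\bigcup_k C k); split.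
  + by apply: bigcupT_measurable => k; have [] := HC k.
  + by rewrite preimage_bigcup; apply: eq_bigcupr => k _; have [] := HC k.
  + by move=> x x'; split => -[k _ Ck]; exists k => //; have [_ _ CC] := HC k; exact/(CC x x').
move=> B [i /= inu [C mC <-]]; exists [set x : rowT | C ((x : 'rV[R]_m) 0%R i)]; split.
- by rewrite -[X in measurable X]setTI; exact: measurable_coord.
- by rewrite setTI.
- by move=> x x'; rewrite /= mxE inu.
Qed.

Let measurable_frozen : measurable_fun setT (fun x : rowT => freeze_prob x).
Proof. by apply: (@measurable_freeze_prob _ rowT id) => i _; exact: measurable_coord. Qed.

(** Integrate over [X'] first. *)
Lemma freeze_mul (f : rowT -> R) : measurable_fun setT f -> (forall x, 0 <= f x)%R ->
  \int[P]_w (f (X w) * \1_D (mix_rows (X w) (X' w)))%:E =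
  \int[P]_w (f (X w) * freeze_prob (X w))%:E.
Proof.
move=> mf f0.
have mmix : measurable_fun setT (fun z : rowT * rowT => mix_rows z.1 z.2 : rowT).
  apply: (@measurable_mix_rows _ _ (@fst rowT rowT) snd) => [i _|]; last exact: measurable_snd.
  exact: measurableT_comp (measurable_coord i) measurable_fst.
rewrite (freeze_integral (F := fun z => (f z.1 * \1_D (mix_rows z.1 z.2))%:E)).
- apply: eq_integral => w _; rewrite EFinM freeze_probE -ge0_integralZl//.
  + apply/measurable_EFinP.
    exact: measurableT_comp (measurable_indic mD) (measurable_mix_cst (X w)).
  + by rewrite lee_fin.
- apply/measurable_EFinP; apply: measurable_funM.
    exact: measurableT_comp mf measurable_fst.
  exact: measurableT_comp (measurable_indic mD) mmix.
- by move=> z; rewrite lee_fin mulr_ge0.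
Qed.

(** An event of the sigma-algebra of [X_nu] does not distinguish [X] from its
    pick-freeze copy, which has the same law; conditioning the copy on [X] gives
    [freeze_prob]. *)
Lemma freeze_prob_is_cond_exp :
  is_cond_exp P (sigma_coords X nu) (fun w => \1_D (X w)) (fun w => freeze_prob (X w)).
Proof.
split.
- apply: (@prob_bounded_integrable _ _ _ _ _ 1%R).
    exact: measurableT_comp measurable_frozen (measurable_funPT X).
  by move=> w; have /andP[? ?] := freeze_prob01 (X w); rewrite ger0_norm.
- move=> B mB.
  pose G := \bigcup_(i in [set` nu]) sigma_of (component X i).
  have := @measurable_freeze_prob _ (g_sigma_algebraType G) X _ measurableT B mB.
  rewrite setTI; apply => i inu _ C mC.
  by apply: sub_sigma_algebra; exists i => //; exists C.
move=> A /sigma_coordsP[C [mC -> CC]].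
have restrictE (f : rowT -> R) :
    \int[P]_(w in X @^-1` C) (f (X w))%:E =
    \int[P]_w (\1_C (X w) * f (X w))%:E.
  rewrite integral_mkcond; apply: eq_integral => w _.
  rewrite patchE indicE; have [/set_mem Cw|/negP/(contra_not mem_set) Cw] := boolP (w \in X @^-1` C).
    by rewrite mem_set// mul1r.
  by rewrite memNset// mul0r.
rewrite !restrictE -freeze_mul//.
rewrite -(pick_freeze_integral (F := fun x => (\1_C x * \1_D x)%:E)).
- apply: eq_integral => w _; congr (_ * _)%:E; rewrite !indicE.
  congr (nat_of_bool _)%:R.
  by apply/idP/idP => /set_mem/CC/mem_set.
- by apply/measurable_EFinP; apply: measurable_funM; exact: measurable_indic.
- by move=> x; rewrite lee_fin mulr_ge0.
Qed.

(** The pick-freeze identity. Integrating over [X'] replaces the indicator of the event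
    for the copy by [freeze_prob (X w)]. This function depends only on the coordinates in
    [nu], so that in the remaining factor [X] can be replaced by its copy and integrated
    in the same way. *)
Lemma pick_freeze_product :
  \int[P]_w (\1_D (X w) * \1_D (mix_rows (X w) (X' w)))%:E =
  \int[P]_w (freeze_prob (X w) ^+ 2)%:E.
Proof.
have p0 x : (0 <= freeze_prob x)%R by have /andP[] := freeze_prob01 x.
under [RHS]eq_integral do rewrite expr2.
rewrite freeze_mul//.
rewrite -(pick_freeze_integral (F := fun x => (\1_D x * freeze_prob x)%:E)).
- rewrite -(freeze_mul measurable_frozen p0); apply: eq_integral => w _.
  by rewrite mulrC /freeze_prob; under eq_set do rewrite mix_rowsA.
- by apply/measurable_EFinP; apply: measurable_funM => //; exact: measurable_indic.
- by move=> x; rewrite lee_fin mulr_ge0.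
Qed.

End PickFreeze.

(** * Conditional expectations and conditional variances *)

Section ConditionalExpectation.
Context d (Omega : measurableType d) (R : realType) (P : probability Omega R).
Variables (G : set (set Omega)) (Y : Omega -> R).
Hypothesis Gm : G `<=` measurable.

Lemma cond_exp_measurable V : is_cond_exp P <<s G >> Y V -> measurable_fun setT V.
Proof.
move=> [_ VG _] _ B mB; rewrite setTI.
apply: (smallest_sub (@sigma_algebra_measurable _ Omega) Gm); exact: VG.
Qed.

(** The event that one version exceeds another one belongs to the sigma-algebra, and
    both versions have the same integral on it. *)
Lemma cond_exp_ge V V' : is_cond_exp P <<s G >> Y V -> is_cond_exp P <<s G >> Y V' ->
  {ae P, forall w, V' w <= V w}.
Proof.
move=> HV HV'; have mV := cond_exp_measurable HV; have mV' := cond_exp_measurable HV'.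
case: HV HV' => iV VG VY [iV' V'G V'Y].
pose A := [set w | V w < V' w].
have GA : <<s G >> A.
  have mG (f : Omega -> R) : (forall B, measurable B -> <<s G >> (f @^-1` B)) ->
      measurable_fun setT (f : g_sigma_algebraType G -> R).
    by move=> fG _ B mB; rewrite setTI; exact: fG.
  exact: (measurable_set_lt (mG _ VG) (mG _ V'G)).
have mA : measurable A by exact: (smallest_sub (@sigma_algebra_measurable _ Omega) Gm) GA.
have iA f : P.-integrable setT (EFin \o f) -> P.-integrable A (EFin \o f).
  by move=> fi; apply: integrableS fi.
have D0 : (\int[P]_(w in A) `|(V' w - V w)%:E| = 0)%E.
  transitivity (\int[P]_(w in A) ((V' w)%:E - (V w)%:E))%E.
    apply: eq_integral => w /set_mem Aw; rewrite EFinB gee0_abs// -EFinB lee_fin subr_ge0.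
    exact: ltW.
  rewrite (integralB mA (iA _ iV') (iA _ iV)) V'Y// VY// subee//.
  by rewrite -VY//; apply: integrable_fin_num => //; exact: iA.
have mB : measurable_fun A (fun w => (V' w - V w)%:E).
  by apply/measurable_EFinP; apply: measurable_funTS; exact: measurable_funB.
have := (ae_eq_integral_abs P mA mB).1 D0.
apply: filterS => w H; rewrite leNgt; apply/negP => Aw.
have := H Aw; rewrite /= => -[/eqP]; rewrite subr_eq0 => /eqP E.
by move: Aw; rewrite E ltxx.
Qed.

(** [cond_exp] selects one version; any two versions agree almost surely. *)
Lemma cond_exp_ae V : is_cond_exp P <<s G >> Y V ->
  {ae P, forall w, cond_exp P <<s G >> Y w = V w}.
Proof.
move=> HV; have HC : is_cond_exp P <<s G >> Y (cond_exp P <<s G >> Y).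
  exact: (xgetI (cst 0) HV).
have le1 := cond_exp_ge HV HC; have le2 := cond_exp_ge HC HV.
by apply: filterS2 le1 le2 => w h1 h2; apply/eqP; rewrite eq_le h1.
Qed.

Lemma expectation_ae (V V' : Omega -> R) : measurable_fun setT V -> measurable_fun setT V' ->
  {ae P, forall w, V w = V' w} -> ('E_P[V] = 'E_P[V'])%E.
Proof.
move=> mV mV' VV'; rewrite unlock; apply: ae_eq_integral => //.
- exact/measurable_EFinP.
- exact/measurable_EFinP.
- by apply: filterS VV' => w -> _.
Qed.

Lemma variance_cond_exp V : is_cond_exp P <<s G >> Y V ->
  ('V_P[cond_exp P <<s G >> Y] = 'V_P[V])%E.
Proof.
move=> HV; have HC : is_cond_exp P <<s G >> Y (cond_exp P <<s G >> Y).
  exact: (xgetI (cst 0) HV).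
have mV := cond_exp_measurable HV; have mC := cond_exp_measurable HC.
rewrite /variance covariance.unlock (expectation_ae mC mV (cond_exp_ae HV)).
have mf c (f : Omega -> R) : measurable_fun setT f ->
    measurable_fun setT ((f \- cst c) * (f \- cst c))%R.
  by move=> mf; apply: measurable_funM; apply: measurable_funB.
apply: expectation_ae; [exact: mf|exact: mf|].
by apply: filterS (cond_exp_ae HV) => w /= E; rewrite /GRing.mul /= E.
Qed.

Lemma variance01 (V : Omega -> R) : measurable_fun setT V -> (forall w, 0 <= V w <= 1) ->
  fine 'V_P[V]%E = fine (\int[P]_w (V w ^+ 2)%:E)%E - fine (\int[P]_w (V w)%:E)%E ^+ 2.
Proof.
move=> mV V01.
have V1 : V \in Lfun P 1.
  apply/Lfun1_integrable; apply: (@prob_bounded_integrable _ _ _ _ _ 1) => // w.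
  by have /andP[? ?] := V01 w; rewrite ger0_norm.
have V2 : (V * V)%R \in Lfun P 1.
  apply/Lfun1_integrable; apply: (@prob_bounded_integrable _ _ _ _ _ 1) => [|w].
    exact: measurable_funM.
  by have /andP[? ?] := V01 w; rewrite ger0_norm ?mulr_ge0// mulr_ile1.
rewrite /variance covarianceE// fineB ?fin_numM ?expectation_fin_num//.
by rewrite fineM ?expectation_fin_num// expectation.unlock.
Qed.

End ConditionalExpectation.

(** * A strong law of large numbers for weakly correlated bounded sums *)

Section SecondMoment.
Context d (Omega : measurableType d) (R : realType) (P : probability Omega R).

(** Expanding the square: uncorrelated pairs do not contribute, the other ones
    contribute at most [C ^+ 2]. *)
Lemma second_moment_bound (I : finType) (A : pred I) (eta : I -> Omega -> R) (C : R)
    (bad : rel I) :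
  (forall i, measurable_fun setT (eta i)) -> (forall i w, `|eta i w| <= C) ->
  (forall i j, A i -> A j -> ~~ bad i j -> (\int[P]_w (eta i w * eta j w)%:E = 0)%E) ->
  (\int[P]_w ((\sum_(i | A i) eta i w) ^+ 2)%:E <=
   (C ^+ 2 * (\sum_i \sum_j bad i j)%N%:R)%:E)%E.
Proof.
move=> mE bE unc.
have iE i j : P.-integrable setT (fun w => (eta i w * eta j w)%:E).
  apply: (@prob_bounded_integrable _ _ _ _ _ (C * C)).
    exact: measurable_funM.
  by move=> w; rewrite normrM ler_pM.
have -> : (\int[P]_w ((\sum_(i | A i) eta i w) ^+ 2)%:E =
    \sum_(i | A i) \sum_(j | A j) \int[P]_w (eta i w * eta j w)%:E)%E.
  transitivity (\int[P]_w (\sum_(i | A i) \sum_(j | A j) (eta i w * eta j w)%:E))%E.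
    apply: eq_integral => w _; rewrite expr2 mulr_suml -sumEFin; apply: eq_bigr => i _.
    by rewrite mulr_sumr -sumEFin.
  rewrite integral_sum//; last by move=> i; exact: integrable_sum.
  by apply: eq_bigr => i _; rewrite integral_sum.
rewrite natr_sum mulr_sumr -sumEFin.
rewrite (le_trans (y := \sum_(i | A i) (C ^+ 2 * (\sum_j bad i j)%N%:R)%:E)%E)//; last first.
  rewrite big_mkcond lee_sum// => i _; case: ifP => // _.
  by rewrite lee_fin mulr_ge0// sqr_ge0.
apply: lee_sum => i Ai; rewrite natr_sum mulr_sumr -sumEFin big_mkcond.
apply: lee_sum => j _; case: ifPn => Aj; last by rewrite lee_fin mulr_ge0// sqr_ge0.
have [ij|/unc->//] := boolP (bad i j); last by rewrite mulr0.
rewrite mulr1 (le_trans (lee_abs _))//.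
rewrite (le_trans (le_abse_integral P measurableT (measurable_int P (iE i j))))//.
rewrite (le_trans (y := \int[P]_w (cst (C ^+ 2)%:E w))%E)//.
  apply: ge0_le_integral => //.
  - by apply: measurableT_comp => //; exact: measurable_int (iE i j).
  - by move=> w _; rewrite lee_fin normrM expr2 ler_pM.
rewrite integral_cst// [X in (_ * X)%E](_ : _ = 1%E) ?mule1//.
exact: probability_setT.
Qed.

Lemma sum_inv_le (n : nat) :
  \sum_(m < n) ((m.+1%:R * m.+2%:R)^-1 : R) = 1 - n.+1%:R^-1.
Proof.
elim: n => [|n IH]; first by rewrite big_ord0 invr1 subrr.
rewrite big_ord_recr /= IH.
have n1 : (n.+1%:R : R) != 0 by rewrite pnatr_eq0.
have n2 : (n.+2%:R : R) != 0 by rewrite pnatr_eq0.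
have E : (n.+2%:R : R) = n.+1%:R + 1 by rewrite natr1.
rewrite E in n2 *; move: n1 n2; move: (n.+1%:R) => x x0 x1.
by field; rewrite x0 x1.
Qed.

(** If the second moments are summable then the sum of the squares is almost surely
    finite, so that its terms tend to 0. *)
Lemma summable_second_moment_cvg (D : nat -> Omega -> R) (C : R) :
  (forall m, measurable_fun setT (D m)) ->
  (forall m, (\int[P]_w (D m w ^+ 2)%:E <= (C * (m.+1%:R * m.+2%:R)^-1)%:E)%E) ->
  {ae P, forall w, D m w @[m --> \oo] --> (0 : R)}.
Proof.
move=> mD bD.
have mD2 m : measurable_fun setT (fun w => (D m w ^+ 2)%:E).
  by apply/measurable_EFinP; exact: measurable_funX.
have D2ge0 m w : (0 <= (D m w ^+ 2)%:E)%E by rewrite lee_fin sqr_ge0.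
pose S w := (\sum_(m <oo) (D m w ^+ 2)%:E)%E.
have SE : (\int[P]_w S w = \sum_(m <oo) \int[P]_w (D m w ^+ 2)%:E)%E.
  by rewrite integral_nneseries.
have Sfin : (\int[P]_w S w < +oo)%E.
  rewrite SE (le_lt_trans _ (ltry C))//; apply: lime_le.
    by apply: is_cvg_nneseries => m _ _; exact: integral_ge0.
  apply: nearW => n; rewrite big_mkord.
  apply: (le_trans (y := (\sum_(m < n) (C * (m.+1%:R * m.+2%:R)^-1)%:E)%E)).
    by apply: lee_sum.
  have C0 : 0 <= C.
    have := le_trans (integral_ge0 _ (fun w _ => D2ge0 0%N w)) (bD 0%N).
    by rewrite lee_fin pmulr_lge0// invr_gt0.
  by rewrite sumEFin lee_fin -mulr_sumr sum_inv_le ler_piMr// gerBl invr_ge0.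
have S0 w : (0 <= S w)%E by exact: nneseries_ge0.
have mS : measurable_fun setT S by apply: ge0_emeasurable_sum.
have iS : P.-integrable setT S.
  apply/integrableP; split => //.
  by under eq_integral do rewrite gee0_abs//.
have := integrable_ae measurableT iS; apply: filterS => w /(_ I) Sw.
have Dc : cvgn (series (fun m => D m w ^+ 2)).
  by apply: nnseries_is_cvg => [m|]; [exact: sqr_ge0|rewrite ltey_eq Sw].
have := cvg_series_cvg_0 Dc.
move=> D20; apply/cvgrPdist_lt => e e0.
have e2 : 0 < e ^+ 2 by rewrite exprn_gt0.
have : \forall m \near \oo, D m w ^+ 2 < e ^+ 2 by exact: cvgr_lt D20 _ e2.
by apply: filterS => m; rewrite sub0r normrN -[D m w ^+ 2]real_normK ?num_real// ltr_pXn2r// nnegrE// ltW.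
Qed.

End SecondMoment.

Section Interpolation.
Context {R : realType}.

Lemma ratio_cvg1 (k : nat) : (m + k).+2%:R / (m + k).+1%:R @[m --> \oo] --> (1 : R).
Proof.
have -> : (fun m => (m + k).+2%:R / (m + k).+1%:R) = (fun m => 1 + harmonic (m + k)%N) :> (nat -> R).
  by apply/funext => m; rewrite -natr1 mulrDl divff ?pnatr_eq0// mul1r.
rewrite -[X in _ --> X]addr0; apply: cvgD; first exact: cvg_cst.
by rewrite (cvg_shiftn k (@harmonic R)); exact: cvg_harmonic.
Qed.

(** For [N] between two consecutive squares, [s N / c N] lies between the quotients of
    [s] at one square by [c] at the other one, and both tend to [theta]. The squares
    start at [2 ^ 2], where [c] is positive. *)
Lemma interpolate_squares (s c : nat -> R) (theta : R) :
  (forall N, 0 <= s N) -> (forall N, s N <= s N.+1) ->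
  (forall N, (2 <= N)%N -> 0 < c N) -> (forall N, c N <= c N.+1) ->
  c (m.+3 ^ 2)%N / c (m.+2 ^ 2)%N @[m --> \oo] --> (1 : R) ->
  s (m.+2 ^ 2)%N / c (m.+2 ^ 2)%N @[m --> \oo] --> theta ->
  s N / c N @[N --> \oo] --> theta.
Proof.
move=> s0 smono c0 cmono c1 sc.
have sle a b : (a <= b)%N -> s a <= s b.
  by move: a b; apply/nondecreasing_seqP.
have cle a b : (a <= b)%N -> c a <= c b.
  by move: a b; apply/nondecreasing_seqP.
have sq0 m : 0 < c (m.+2 ^ 2)%N by apply: c0; rewrite (leq_trans (n := 4))// (leq_exp2r 2 _ (e := 2)).
have up : s (m.+3 ^ 2)%N / c (m.+2 ^ 2)%N @[m --> \oo] --> theta.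
  have : s (m.+3 ^ 2)%N / c (m.+3 ^ 2)%N * (c (m.+3 ^ 2)%N / c (m.+2 ^ 2)%N) @[m --> \oo] --> theta * 1.
    apply: cvgM => //.
    by rewrite -(cvg_shiftS (fun m => s (m.+2 ^ 2)%N / c (m.+2 ^ 2)%N)) in sc.
  rewrite mulr1; apply: cvg_trans; apply: near_eq_cvg; apply: nearW => m.
  by rewrite mulrA divfK// lt0r_neq0// (sq0 m.+1).
have lo : s (m.+2 ^ 2)%N / c (m.+3 ^ 2)%N @[m --> \oo] --> theta.
  have : s (m.+2 ^ 2)%N / c (m.+2 ^ 2)%N * (c (m.+3 ^ 2)%N / c (m.+2 ^ 2)%N)^-1 @[m --> \oo] --> theta * 1^-1.
    by apply: cvgM => //; apply: cvgV; rewrite ?oner_eq0.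
  rewrite invr1 mulr1; apply: cvg_trans; apply: near_eq_cvg; apply: nearW => m.
  by rewrite invf_div mulrA divfK// lt0r_neq0// sq0.
apply/cvgrPdist_lt => e e0.
have [m0 _ Hm0] : \forall m \near \oo, s (m.+3 ^ 2)%N / c (m.+2 ^ 2)%N < theta + e /\
    theta - e < s (m.+2 ^ 2)%N / c (m.+3 ^ 2)%N.
  near=> m; split; near: m; [apply: cvgr_lt up _ _|apply: cvgr_gt lo _ _]; lra.
exists (m0.+2 ^ 2)%N => // N /= NM.
have [m [m0m mN Nm]] : exists m, [/\ (m0 <= m)%N, (m.+2 ^ 2 <= N)%N & (N < m.+3 ^ 2)%N].
  have ex : exists m, ((m.+2 ^ 2)%N <= N)%N by exists m0.
  have ub m : ((m.+2 ^ 2)%N <= N)%N -> (m <= N)%N by lia.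
  case: (ex_maxnP ex ub) => m mN mmax; exists m; split=> //; first exact: mmax.
  by rewrite ltnNge; apply/negP => /mmax; rewrite ltnn.
have [h1 h2] := Hm0 m m0m.
have N2 : (2 <= N)%N by lia.
have cN := c0 _ N2.
have l1 : s N / c N <= s (m.+3 ^ 2)%N / c (m.+2 ^ 2)%N.
  by rewrite ler_pM ?invr_ge0 ?(ltW cN) ?sle 1?ltnW// lef_pV2 ?posrE// cle.
have l2 : s (m.+2 ^ 2)%N / c (m.+3 ^ 2)%N <= s N / c N.
  by rewrite ler_pM ?invr_ge0 ?(ltW (sq0 _)) ?sle// lef_pV2 ?posrE// cle// ltnW.
by rewrite ltr_distlC; apply/andP; split; lra.
Unshelve. all: by end_near. Qed.

(** The number of quadruples [((k1, k2), (j, l))] of indices less than [N] such that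
    [k1 < k2]. *)
Definition quad_count (N : nat) : R := 'C(N, 2)%:R * N%:R ^+ 2.

Lemma bin2R (N : nat) : 'C(N, 2)%:R = N%:R * (N%:R - 1) / 2 :> R.
Proof.
have := bin_ffact N 2; rewrite ffactnS ffactn1 => /(congr1 (fun k => k%:R : R)).
rewrite !natrM !mulr1 => E.
have -> : N%:R * (N%:R - 1) = N%:R * N.-1%:R :> R.
  by case: N {E} => [|N]; [rewrite !mul0r|rewrite -[N.+1%:R]natr1 addrK].
by rewrite -E mulfK.
Qed.

Lemma quad_count_gt0 N : (2 <= N)%N -> 0 < quad_count N.
Proof. by move=> N2; rewrite mulr_gt0 ?exprn_gt0 ?ltr0n ?bin_gt0//; lia. Qed.

Lemma quad_count_le N : quad_count N <= quad_count N.+1.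
Proof.
by rewrite ler_pM ?exprn_ge0// ?ler_nat ?leq_bin2l// lerXn2r ?nnegrE ?ler_nat.
Qed.

Lemma quad_count_ge N : (2 <= N)%N -> N%:R ^+ 4 / 4 <= quad_count N.
Proof.
move=> N2; rewrite /quad_count bin2R; have : 2 <= N%:R :> R by rewrite ler_nat.
move: (N%:R : R) => x x2.
have -> : x ^+ 4 / 4 = x ^+ 2 * (x / 4 * x) by ring.
have -> : x * (x - 1) / 2 * x ^+ 2 = x ^+ 2 * (x * (x - 1) / 2) by ring.
by rewrite ler_pM2l ?exprn_gt0; nra.
Qed.

Lemma quad_count_ratio :
  quad_count (m.+3 ^ 2)%N / quad_count (m.+2 ^ 2)%N @[m --> \oo] --> (1 : R).
Proof.
(* For [n = m.+2], [quad_count (n ^ 2) = n ^ 6 * (n - 1) * (n + 1) / 2]. *)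
pose a k m : R := (m + k).+2%:R / (m + k).+1%:R.
have -> : (fun m => quad_count (m.+3 ^ 2)%N / quad_count (m.+2 ^ 2)%N) =
    (fun m => a 1%N m ^+ 6 * (a 0%N m * a 2%N m)).
  apply/funext => m; rewrite /quad_count /a !bin2R addn0 addn1 addn2 !natrX.
  have E k : (k.+1%:R : R) = k%:R + 1 by rewrite natr1.
  rewrite !E; have : 0 <= m%:R :> R by [].
  move: (m%:R : R) => x x0.
  by field; repeat (apply/andP; split); rewrite ?mulf_neq0 ?expf_neq0//; apply: lt0r_neq0; nra.
have -> : 1 = 1 ^+ 6 * (1 * 1) :> R by rewrite expr1n !mulr1.
apply: cvgM; last by apply: cvgM; exact: ratio_cvg1.
exact: (cvg_comp _ _ (@ratio_cvg1 1) (@exprn_continuous _ 6 1)).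
Qed.

End Interpolation.

Section CountingCoincidences.
Variable N : nat.
Notation quad := (('I_N * 'I_N) * ('I_N * 'I_N))%type.

(** When this fails, [j != l] in both quadruples [((k1, k2), (j, l))] and they have no
    index in common, so that the values of the kernel there are uncorrelated. *)
Definition coincide (q r : quad) : bool :=
  [|| q.2.1 == q.2.2, r.2.1 == r.2.2,
      q.1.1 == r.1.1, q.1.1 == r.1.2, q.1.2 == r.1.1, q.1.2 == r.1.2,
      q.2.1 == r.2.1, q.2.1 == r.2.2, q.2.2 == r.2.1 | q.2.2 == r.2.2].

Let sum_fst (A B : finType) (F : A -> nat) : \sum_(p : A * B) F p.1 = ((\sum_a F a) * #|B|)%N.
Proof.
rewrite -(pair_bigA _ (fun a _ => F a)) big_distrl; apply: eq_bigr => a _.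
by rewrite sum_nat_const mulnC.
Qed.

Let sum_snd (A B : finType) (F : B -> nat) : \sum_(p : A * B) F p.2 = (#|A| * \sum_b F b)%N.
Proof. by rewrite -(pair_bigA _ (fun _ b => F b)) sum_nat_const. Qed.

Let sum_eq1 (c : 'I_N) : (\sum_a (a == c) = 1)%N.
Proof. by rewrite (bigD1 c)//= eqxx big1 ?addn0 // => i /negbTE->. Qed.

(** Each of the ten equations leaves seven free indices out of eight. *)
Lemma sum_coincide : (\sum_q \sum_r coincide q r <= 10 * N ^ 7)%N.
Proof.
pose cnt (b : rel quad) := (\sum_q \sum_r b q r)%N.
have cntU b b' : (cnt (fun q r => b q r || b' q r) <= cnt b + cnt b')%N.
  rewrite /cnt -big_split leq_sum// => q _; rewrite -big_split leq_sum// => r _.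
  by case: (b q r); case: (b' q r).
have cQ : #|{: quad}| = (N ^ 4)%N by rewrite !card_prod card_ord; lia.
have cI : #|{: 'I_N * 'I_N}| = (N ^ 2)%N by rewrite !card_prod card_ord; lia.
have fib (p : quad -> 'I_N) (p' : quad -> 'I_N) :
    (forall c, \sum_r (p' r == c) = N ^ 3)%N -> (cnt (fun q r => p q == p' r) <= N ^ 7)%N.
  move=> H; rewrite /cnt (eq_bigr (fun=> (N ^ 3)%N)); last first.
    by move=> q _; rewrite -(H (p q)); apply: eq_bigr => r _; rewrite eq_sym.
  by rewrite sum_nat_const cQ -expnD.
pose at1 c (p : 'I_N * 'I_N) : nat := p.1 == c; pose at2 c (p : 'I_N * 'I_N) : nat := p.2 == c.
have s1 c : (\sum_p at1 c p = N)%N.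
  by rewrite (sum_fst _ (fun a => (a == c : nat))) sum_eq1 card_ord mul1n.
have s2 c : (\sum_p at2 c p = N)%N.
  by rewrite (sum_snd _ (fun a => (a == c : nat))) sum_eq1 card_ord muln1.
have f11 c : (\sum_(r : quad) (r.1.1 == c) = N ^ 3)%N.
  by rewrite (sum_fst _ (at1 c)) s1 cI; lia.
have f12 c : (\sum_(r : quad) (r.1.2 == c) = N ^ 3)%N.
  by rewrite (sum_fst _ (at2 c)) s2 cI; lia.
have f21 c : (\sum_(r : quad) (r.2.1 == c) = N ^ 3)%N.
  by rewrite (sum_snd _ (at1 c)) s1 cI; lia.
have f22 c : (\sum_(r : quad) (r.2.2 == c) = N ^ 3)%N.
  by rewrite (sum_snd _ (at2 c)) s2 cI; lia.
have diag : (\sum_(r : quad) (r.2.1 == r.2.2) = N ^ 3)%N.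
  rewrite (sum_snd _ (fun p : 'I_N * 'I_N => (p.1 == p.2 : nat))) cI.
  rewrite -(pair_bigA _ (fun a b : 'I_N => (a == b : nat))) (eq_bigr (fun=> 1%N)).
    by rewrite sum_nat_const card_ord; lia.
  by move=> a _; rewrite -[RHS](sum_eq1 a); apply: eq_bigr => b _; rewrite eq_sym.
have step (b b' : rel quad) k : (cnt b <= N ^ 7)%N -> (cnt b' <= k * N ^ 7)%N ->
    (cnt (fun q r => b q r || b' q r) <= k.+1 * N ^ 7)%N.
  by move=> h h'; rewrite (leq_trans (cntU _ _))// mulSn leq_add.
rewrite -[X in (X <= _)%N]/(cnt coincide) /coincide.
apply: (step).
  rewrite /cnt exchange_big (eq_bigr (fun=> (N ^ 3)%N)) => [|r _]; last exact: diag.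
  by rewrite sum_nat_const cQ -expnD.
apply: (step).
  rewrite /cnt (eq_bigr (fun=> (N ^ 3)%N)) => [|r _]; last exact: diag.
  by rewrite sum_nat_const cQ -expnD.
apply: (step); first exact: fib f11.
apply: (step); first exact: fib f12.
apply: (step); first exact: fib f11.
apply: (step); first exact: fib f12.
apply: (step); first exact: fib f21.
apply: (step); first exact: fib f22.
apply: (step); first exact: fib f21.
by rewrite mul1n; exact: fib f22.
Qed.

End CountingCoincidences.

Lemma sum_ltn_pairs (N : nat) :
  (\sum_(tau : 'I_N * 'I_N | (tau.1 < tau.2)%N) 1 = 'C(N, 2))%N.
Proof.
rewrite -(pair_big_dep predT (fun k1 k2 : 'I_N => (k1 < k2)%N) (fun _ _ => 1%N)) /=.
rewrite (exchange_big_dep predT)//= -bin2_sum big_mkord; apply: eq_bigr => k2 _.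
by rewrite (big_ord_narrow (ltnW (ltn_ord k2))) sum_nat_const card_ord muln1.
Qed.

Section QuadrupleLLN.
Context d (Omega : measurableType d) (R : realType) (P : probability Omega R).
Variables (xi : (nat * nat) * (nat * nat) -> Omega -> R) (C theta : R).
Hypothesis mxi : forall q, measurable_fun setT (xi q).
Hypothesis xi01 : forall q w, 0 <= xi q w <= C.
Hypothesis theta01 : 0 <= theta <= C.

(** The quadruples that select four independent sample points. *)
Definition good_quad (q : (nat * nat) * (nat * nat)) : bool :=
  (q.1.1 < q.1.2)%N && (q.2.1 != q.2.2).

Definition disjoint_quads (q r : (nat * nat) * (nat * nat)) : bool :=
  [&& q.1.1 != r.1.1, q.1.1 != r.1.2, q.1.2 != r.1.1, q.1.2 != r.1.2,
      q.2.1 != r.2.1, q.2.1 != r.2.2, q.2.2 != r.2.1 & q.2.2 != r.2.2].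

Hypothesis xi_uncorrelated : forall q r, good_quad q -> good_quad r ->
  disjoint_quads q r ->
  (\int[P]_w ((xi q w - theta) * (xi r w - theta))%:E = 0)%E.

Definition quad_sum (N : nat) (w : Omega) : R :=
  \sum_(tau : 'I_N * 'I_N | (tau.1 < tau.2)%N)
     \sum_(j < N) \sum_(l < N) xi ((tau.1 : nat, tau.2 : nat), (j : nat, l : nat)) w.

Let quad_val N (q : ('I_N * 'I_N) * ('I_N * 'I_N)) : (nat * nat) * (nat * nat) :=
  ((q.1.1 : nat, q.1.2 : nat), (q.2.1 : nat, q.2.2 : nat)).

Let measurable_sum_cond (I : finType) (A : pred I) (h : I -> Omega -> R) :
  (forall i, measurable_fun setT (h i)) ->
  measurable_fun setT (fun w => \sum_(i | A i) h i w).
Proof.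
move=> mh; under eq_fun do rewrite big_mkcond.
by apply: measurable_sum => i; case: (A i); [exact: mh|exact: measurable_cst].
Qed.

Lemma quad_sumE N w : quad_sum N w =
  \sum_(q : ('I_N * 'I_N) * ('I_N * 'I_N) | (q.1.1 < q.1.2)%N) xi (quad_val q) w.
Proof.
rewrite /quad_sum; under eq_bigr do rewrite pair_bigA.
by rewrite pair_big; apply: eq_bigl => q; rewrite andbT.
Qed.

Lemma quad_countE N :
  \sum_(q : ('I_N * 'I_N) * ('I_N * 'I_N) | (q.1.1 < q.1.2)%N) (1 : R) = quad_count N.
Proof.
suff E : (\sum_(q : ('I_N * 'I_N) * ('I_N * 'I_N) | (q.1.1 < q.1.2)%N) 1 =
    'C(N, 2) * N ^ 2)%N.
  by rewrite -(natr_sum R _ _ (fun=> 1%N)) E natrM natrX.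
transitivity (\sum_(tau : 'I_N * 'I_N | (tau.1 < tau.2)%N) \sum_(p : 'I_N * 'I_N) 1)%N.
  by rewrite pair_big; apply: eq_bigl => q; rewrite andbT.
have cI : (\sum_(p : 'I_N * 'I_N) 1 = N ^ 2)%N by rewrite sum_nat_const card_prod card_ord; lia.
rewrite (eq_bigr (fun=> 1 * N ^ 2)%N) => [|tau _]; last by rewrite cI mul1n.
by rewrite -big_distrl /= sum_ltn_pairs.
Qed.

Lemma quad_sum_ge0 N w : 0 <= quad_sum N w.
Proof.
by rewrite quad_sumE sumr_ge0// => q _; have /andP[] := xi01 (quad_val q) w.
Qed.

Lemma quad_sum_le N w : quad_sum N w <= quad_sum N.+1 w.
Proof.
have mono (F G : nat -> R) n : (forall i, 0 <= G i) -> (forall i, F i <= G i) ->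
    \sum_(i < n) F i <= \sum_(i < n.+1) G i.
  by move=> G0 FG; rewrite big_ord_recr /= -[leLHS]addr0 lerD// ler_sum.
have E n : quad_sum n w = \sum_(k1 < n) \sum_(k2 < n) (k1 < k2)%N%:R *
    \sum_(j < n) \sum_(l < n) xi ((k1 : nat, k2 : nat), (j : nat, l : nat)) w.
  rewrite /quad_sum big_mkcond (pair_bigA _ (fun k1 k2 : 'I_n => (k1 < k2)%N%:R *
    \sum_(j < n) \sum_(l < n) xi ((k1 : nat, k2 : nat), (j : nat, l : nat)) w)).
  by apply: eq_bigr => tau _; case: ifP; rewrite ?mul1r ?mul0r.
have x0 q : 0 <= xi q w by have /andP[] := xi01 q w.
have s0 n k1 k2 : 0 <= \sum_(j < n) \sum_(l < n) xi ((k1, k2), (j : nat, l : nat)) w.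
  by apply: sumr_ge0 => j _; exact: sumr_ge0.
rewrite !E.
apply: (mono (fun k1 => \sum_(k2 < N) (k1 < k2)%N%:R *
    \sum_(j < N) \sum_(l < N) xi ((k1 : nat, k2 : nat), (j : nat, l : nat)) w)
  (fun k1 => \sum_(k2 < N.+1) (k1 < k2)%N%:R *
    \sum_(j < N.+1) \sum_(l < N.+1) xi ((k1 : nat, k2 : nat), (j : nat, l : nat)) w)).
  by move=> k1; apply: sumr_ge0 => k2 _; rewrite mulr_ge0.
move=> k1; apply: (mono (fun k2 => (k1 < k2)%N%:R *
    \sum_(j < N) \sum_(l < N) xi ((k1 : nat, k2 : nat), (j : nat, l : nat)) w)
  (fun k2 => (k1 < k2)%N%:R *
    \sum_(j < N.+1) \sum_(l < N.+1) xi ((k1 : nat, k2 : nat), (j : nat, l : nat)) w)).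
  by move=> k2; rewrite mulr_ge0.
move=> k2; rewrite ler_wpM2l//.
apply: (mono (fun j => \sum_(l < N) xi ((k1 : nat, k2 : nat), (j : nat, l : nat)) w)
  (fun j => \sum_(l < N.+1) xi ((k1 : nat, k2 : nat), (j : nat, l : nat)) w)) => j.
  exact: sumr_ge0.
exact: (mono (fun l => xi ((k1 : nat, k2 : nat), (j : nat, l : nat)) w)
  (fun l => xi ((k1 : nat, k2 : nat), (j : nat, l : nat)) w)).
Qed.

(** The second moment of the sum is at most [C ^+ 2] times the number of coincident
    pairs, which is at most [10 * N ^ 7], and [quad_count N ^+ 2] is at least
    [N ^+ 8 / 16]. *)
Lemma quad_mean_second_moment N : (2 <= N)%N ->
  (\int[P]_w ((quad_sum N w / quad_count N - theta) ^+ 2)%:E <=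
   (160 * C ^+ 2 / N%:R)%:E)%E.
Proof.
move=> N2; have c0 := quad_count_gt0 (R := R) N2.
pose eta (q : ('I_N * 'I_N) * ('I_N * 'I_N)) w := xi (quad_val q) w - theta.
have meta q : measurable_fun setT (eta q) by exact: measurable_funB.
have beta q w : `|eta q w| <= C.
  have /andP[x0 xC] := xi01 (quad_val q) w; have /andP[t0 tC] := theta01.
  rewrite ler_norml /eta; move: x0 xC; move: (xi _ w) => x x0 xC.
  by apply/andP; split; lra.
have unc (q r : ('I_N * 'I_N) * ('I_N * 'I_N)) : (q.1.1 < q.1.2)%N -> (r.1.1 < r.1.2)%N -> ~~ coincide q r ->
    (\int[P]_w (eta q w * eta r w)%:E = 0)%E.
  move=> q1 r1; rewrite /coincide !negb_or.
  move=> /andP[qn /andP[rn dis]]; apply: xi_uncorrelated; rewrite /good_quad /=.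
  - by rewrite q1.
  - by rewrite r1.
  - exact: dis.
have H := @second_moment_bound _ _ _ P _ (fun q : ('I_N * 'I_N) * ('I_N * 'I_N) => (q.1.1 < q.1.2)%N)
  eta C (@coincide N) meta beta unc.
have E w : (quad_sum N w / quad_count N - theta) ^+ 2 =
    (quad_count N) ^- 2 * (\sum_(q : ('I_N * 'I_N) * ('I_N * 'I_N) | (q.1.1 < q.1.2)%N) eta q w) ^+ 2.
  rewrite sumrB -quad_sumE (eq_bigr (fun=> theta * 1)); last by move=> *; rewrite mulr1.
  rewrite -mulr_sumr quad_countE -exprVn -exprMn; congr (_ ^+ 2).
  by field; exact: lt0r_neq0.
under eq_integral do rewrite E EFinM.
rewrite ge0_integralZl//; last 3 first.
- by apply/measurable_EFinP; apply: measurable_funX; exact: measurable_sum_cond.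
- by move=> w _; rewrite lee_fin sqr_ge0.
- by rewrite lee_fin invr_ge0 exprn_ge0// ltW.
apply: (le_trans (lee_wpmul2l _ H)).
  by rewrite lee_fin invr_ge0 exprn_ge0// ltW.
rewrite -EFinM lee_fin mulrC ler_pdivrMr ?exprn_gt0//.
have N0 : 0 < N%:R :> R by rewrite ltr0n; lia.
have cb := quad_count_ge (R := R) N2.
have sb : (\sum_q \sum_r @coincide N q r)%N%:R <= 10 * N%:R ^+ 7 :> R.
  by rewrite -natrX -natrM ler_nat sum_coincide.
rewrite (le_trans (ler_wpM2l (sqr_ge0 C) sb))//.
have x0 : 0 <= N%:R ^+ 4 / 4 :> R by rewrite divr_ge0// exprn_ge0.
have c2 : (N%:R ^+ 4 / 4) ^+ 2 <= quad_count N ^+ 2 :> R.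
  by rewrite lerXn2r ?nnegrE// ltW.
apply: (le_trans (y := 160 * C ^+ 2 / N%:R * (N%:R ^+ 4 / 4) ^+ 2)).
  rewrite le_eqVlt; apply/orP; left; apply/eqP; field; exact: lt0r_neq0.
have r0 : 0 <= 160 * C ^+ 2 / N%:R.
  by apply: divr_ge0 => //; apply: mulr_ge0 => //; exact: sqr_ge0.
exact: ler_wpM2l r0 _ _ c2.
Qed.

(** Strong law: almost sure convergence along the squares follows from the bound on
    the second moments, and extends to all sample sizes because the sums increase. *)
Lemma quad_slln :
  {ae P, forall w, quad_sum N w / quad_count N @[N --> \oo] --> theta}.
Proof.
have msum N : measurable_fun setT (quad_sum N).
  rewrite (funext (quad_sumE N)).
  by apply: measurable_sum_cond => q; exact: mxi.
pose D m w := quad_sum (m.+2 ^ 2) w / quad_count (m.+2 ^ 2) - theta.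
have mD m : measurable_fun setT (D m).
  by apply: measurable_funB => //; exact: measurable_funM.
(* The bound at [N = m.+2 ^ 2] is weakened to one with a telescoping sum. *)
have bD m : (\int[P]_w (D m w ^+ 2)%:E <=
    (160 * C ^+ 2 * (m.+1%:R * m.+2%:R)^-1)%:E)%E.
  apply: (le_trans (quad_mean_second_moment _)); first by lia.
  have C0 : 0 <= 160 * C ^+ 2 by apply: mulr_ge0 => //; exact: sqr_ge0.
  rewrite lee_fin; apply: ler_wpM2l => //; rewrite -natrM lef_pV2 ?posrE ?ltr0n//.
  by rewrite ler_nat; lia.
have := summable_second_moment_cvg mD bD; apply: filterS => w H.
apply: (@interpolate_squares R (quad_sum^~ w) (@quad_count R) theta).
- by move=> N; exact: quad_sum_ge0.
- by move=> N; exact: quad_sum_le.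
- exact: quad_count_gt0.
- exact: quad_count_le.
- exact: quad_count_ratio.
- have : quad_sum (m.+2 ^ 2) w / quad_count (m.+2 ^ 2) - theta + theta @[m --> \oo] --> 0 + theta.
    by apply: cvgD => //; exact: cvg_cst.
  by rewrite add0r; under eq_cvg do rewrite subrK.
Qed.

End QuadrupleLLN.

(** * The Pick-Freeze estimator *)

Section GroupedElements.
Context d (Omega : measurableType d) (R : realType) (P : probability Omega R).
Variables (I : choiceType) (F : I -> set (set Omega)).
Hypothesis Fm : forall i, F i `<=` measurable.
Hypothesis FI : forall i, setI_closed (F i).
Hypothesis FT : forall i, F i setT.
Hypothesis indF : mutually_independent P F.

(** Measurability for this sigma-algebra says that a random element depends only on the
    members of the family indexed by [s]. *)
Definition group_type (s : seq I) := g_sigma_algebraType (sigma_group F s).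

Lemma group_measurable s i d' (T : measurableType d') (Y : Omega -> T) :
  i \in s -> sigma_of Y `<=` F i -> measurable_fun setT (Y : group_type s -> T).
Proof.
move=> is_ YF _ B mB; apply: sub_sigma_algebra; exists i => //; apply: YF.
by exists B.
Qed.

Lemma group_independent s t d1 d2 (T1 : measurableType d1) (T2 : measurableType d2)
    (U : Omega -> T1) (V : Omega -> T2) :
  uniq (s ++ t) -> measurable_fun setT (U : group_type s -> T1) ->
  measurable_fun setT (V : group_type t -> T2) ->
  independent_sets P (sigma_of U) (sigma_of V).
Proof.
move=> st mU mV _ _ [A mA <-] [B mB <-].
apply: (mutually_independent_groups Fm FI FT indF st).
- exact: mU.
- exact: mV.
Qed.

End GroupedElements.

Section SigmaOf.
Context d (Omega : measurableType d) d' (T : measurableType d') (Y : Omega -> T).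

Lemma sigma_of_measurable : measurable_fun setT Y -> sigma_of Y `<=` measurable.
Proof. by move=> mY _ [B mB <-]; exact: mY. Qed.

Lemma sigma_of_setI : setI_closed (sigma_of Y).
Proof.
move=> _ _ [B mB <-] [C mC <-]; exists (B `&` C); first exact: measurableI.
by rewrite !setTI preimage_setI.
Qed.

Lemma sigma_of_setT : sigma_of Y setT.
Proof. by exists setT; [exact: measurableT|rewrite setTI preimage_setT]. Qed.

End SigmaOf.

Section IntegralTools.
Context d (Omega : measurableType d) (R : realType) (P : probability Omega R).
Local Open Scope ereal_scope.

(** Both sides are the integral of [F] against the product of the two marginal laws. *)
Lemma independent_same_law_integral d1 d2 (T1 : measurableType d1) (T2 : measurableType d2)
    (U U0 : Omega -> T1) (V V0 : Omega -> T2) (F : T1 * T2 -> \bar R) :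
  measurable_fun setT U -> measurable_fun setT U0 ->
  measurable_fun setT V -> measurable_fun setT V0 ->
  independent_sets P (sigma_of U) (sigma_of V) ->
  same_law P U U0 -> same_law P V V0 ->
  measurable_fun setT F -> (forall x, 0 <= F x) ->
  \int[P]_w F (U w, V w) = \int[P]_w \int[P]_w' F (U0 w, V0 w').
Proof.
move=> mU mU0 mV mV0 UV UU0 VV0 mF F0.
rewrite independent_integral//.
transitivity (\int[P]_w \int[P]_w' F (U w, V0 w')).
  apply: eq_integral => w _.
  apply: (same_law_integral mV mV0 VV0 (F := fun v => F (U w, v))) => //.
  by apply: measurableT_comp => //; exact: measurable_pair1.
apply: (same_law_integral mU mU0 UU0 (F := fun u => \int[P]_w' F (u, V0 w'))).
  apply: (@measurable_fun_fubini_tonelli_F _ _ _ _ _ P (fun z : T1 * Omega => F (z.1, V0 z.2))).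
    apply: measurableT_comp => //; apply: measurable_fun_pair => //.
    exact: measurableT_comp.
  by move=> z.
by move=> u; exact: integral_ge0.
Qed.

Lemma integral_affine (a b c : R) (u v : Omega -> R) :
  P.-integrable setT (EFin \o u) -> P.-integrable setT (EFin \o v) ->
  \int[P]_w (a + b * u w + c * v w)%:E =
  (a + b * fine (\int[P]_w (u w)%:E) + c * fine (\int[P]_w (v w)%:E))%:E.
Proof.
move=> iu iv.
have fu : \int[P]_w (u w)%:E \is a fin_num by exact: integrable_fin_num iu.
have fv : \int[P]_w (v w)%:E \is a fin_num by exact: integrable_fin_num iv.
have ia : P.-integrable setT (cst a%:E) by exact: finite_measure_integrable_cst.
have ib : P.-integrable setT (fun w => b%:E * (u w)%:E) by exact: integrableZl.
have ic : P.-integrable setT (fun w => c%:E * (v w)%:E) by exact: integrableZl.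
under eq_integral do rewrite !EFinD !EFinM.
rewrite integralD//; last exact: integrableD.
rewrite integralD// !integralZl//.
rewrite integral_cst// !EFinD !EFinM !fineK//.
by rewrite [X in (_ * X)%E](_ : _ = 1%E) ?mule1//; exact: probability_setT.
Qed.

Lemma prob_integral_bounds (f : Omega -> R) (c : R) : measurable_fun setT f ->
  (forall w, 0 <= f w <= c)%R -> (0 <= fine (\int[P]_w (f w)%:E) <= c)%R.
Proof.
move=> mf fc.
have f0 w : (0 <= f w)%R by have /andP[] := fc w.
have f1 w : (f w <= c)%R by have /andP[] := fc w.
have i_f : P.-integrable setT (EFin \o f).
  by apply: (@prob_bounded_integrable _ _ _ _ _ c) => // w; rewrite ger0_norm.
rewrite fine_ge0/=; last by apply: integral_ge0 => w _; rewrite lee_fin.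
rewrite -lee_fin fineK; last exact: integrable_fin_num i_f.
apply: (@le_trans _ _ (\int[P]_w (cst c%:E w))).
  apply: ge0_le_integral => //.
  - by move=> w _; rewrite lee_fin.
  - exact/measurable_EFinP.
  - by move=> w _; rewrite lee_fin.
by rewrite integral_cst// [X in (_ * X)%E](_ : _ = 1%E) ?mule1//; exact: probability_setT.
Qed.

End IntegralTools.

Section Kernel.
Context {R : realType} (M : completePMetricType R).
Notation borelM := (borel M).

Hypothesis measurable_ball : forall d (T : measurableType d) (f g h : T -> borelM),
  measurable_fun setT f -> measurable_fun setT g -> measurable_fun setT h ->
  measurable [set w | geodesic_ball (f w : M) (g w) (h w)].

Lemma ball_ind_indic (S : Type) (A : set S) w (p q z : M) :
  (A w <-> geodesic_ball p q z) -> ball_ind p q z = \1_A w.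
Proof.
move=> Aw; rewrite /ball_ind !indicE; congr (nat_of_bool _)%:R.
by apply/idP/idP => /set_mem/Aw/mem_set.
Qed.

Lemma measurable_ball_ind d (T : measurableType d) (f g h : T -> borelM) :
  measurable_fun setT f -> measurable_fun setT g -> measurable_fun setT h ->
  measurable_fun setT (fun w => ball_ind (f w : M) (g w) (h w)).
Proof.
move=> mf mg mh; have mA := measurable_ball mf mg mh.
have -> : (fun w => ball_ind (f w : M) (g w) (h w)) =
    \1_[set w | geodesic_ball (f w : M) (g w) (h w)].
  by apply/funext => w; exact: ball_ind_indic.
exact: measurable_indic.
Qed.

Lemma ball_ind01 (p q z : M) : 0 <= ball_ind p q z <= 1.
Proof. by rewrite /ball_ind indicE; case: (_ \in _); rewrite ?lexx ?ler01. Qed.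

(** The square of an average over [j] is a double average over [j] and [l]: so the
    average of the kernel over index quadruples is one plus the estimator. Adding one
    makes the kernel nonnegative, hence its sums nondecreasing in the sample size. *)
Definition kernel (p q : M) (t t' : M * M) : R :=
  1 + ball_ind p q t.1 * ball_ind p q t.2 -
  (ball_ind p q t.1 + ball_ind p q t.2) / 2 *
  ((ball_ind p q t'.1 + ball_ind p q t'.2) / 2).

Lemma kernel02 p q t t' : 0 <= kernel p q t t' <= 2.
Proof.
rewrite /kernel; have := ball_ind01 p q t.1; have := ball_ind01 p q t.2.
have := ball_ind01 p q t'.1; have := ball_ind01 p q t'.2.
move: (ball_ind p q t.1) (ball_ind p q t.2) (ball_ind p q t'.1) (ball_ind p q t'.2).
move=> a b a' b' /andP[? ?] /andP[? ?] /andP[? ?] /andP[? ?].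
by apply/andP; split; nra.
Qed.

Lemma measurable_kernel d (T : measurableType d) (p q : T -> borelM)
    (t t' : T -> borelM * borelM) :
  measurable_fun setT p -> measurable_fun setT q ->
  measurable_fun setT t -> measurable_fun setT t' ->
  measurable_fun setT (fun w => kernel (p w) (q w) (t w) (t' w)).
Proof.
move=> mp mq mt mt'.
have m1 (s : T -> borelM * borelM) : measurable_fun setT s ->
    measurable_fun setT (fun w => ball_ind (p w : M) (q w) (s w).1).
  by move=> ms; apply: measurable_ball_ind => //; exact: measurableT_comp measurable_fst ms.
have m2 (s : T -> borelM * borelM) : measurable_fun setT s ->
    measurable_fun setT (fun w => ball_ind (p w : M) (q w) (s w).2).
  by move=> ms; apply: measurable_ball_ind => //; exact: measurableT_comp measurable_snd ms.
rewrite /kernel; apply: measurable_funB.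
  apply: measurable_funD; first exact: measurable_cst.
  by apply: measurable_funM; [exact: m1|exact: m2].
by apply: measurable_funM; apply: measurable_funM => //; apply: measurable_funD;
  (exact: m1 || exact: m2).
Qed.

Lemma estimatorE d (Omega : measurableType d) (Zs Znus Ws : nat -> Omega -> M) (N : nat)
    (w : Omega) : (2 <= N)%N ->
  quad_sum (fun q w => kernel (Ws q.1.1 w) (Ws q.1.2 w)
      (Zs q.2.1 w, Znus q.2.1 w) (Zs q.2.2 w, Znus q.2.2 w)) N w / quad_count N =
  1 + estimator Zs Znus Ws N w.
Proof.
move=> N2; have n0 : N%:R != 0 :> R by rewrite pnatr_eq0; lia.
have c0 : 'C(N, 2)%:R != 0 :> R by rewrite pnatr_eq0 -lt0n bin_gt0.
pose e (tau : 'I_N * 'I_N) := let h z := ball_ind (Ws tau.1 w) (Ws tau.2 w) z in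
  N%:R^-1 * (\sum_(j < N) h (Zs j w) * h (Znus j w))
  - ((2 * N%:R)^-1 * \sum_(j < N) (h (Zs j w) + h (Znus j w))) ^+ 2.
have E (tau : 'I_N * 'I_N) : \sum_(j < N) \sum_(l < N)
    kernel (Ws tau.1 w) (Ws tau.2 w) (Zs j w, Znus j w) (Zs l w, Znus l w) =
    N%:R ^+ 2 * (1 + e tau).
  rewrite /kernel /e /=; set h := ball_ind (Ws tau.1 w) (Ws tau.2 w).
  pose a j := h (Zs j w) * h (Znus j w); pose b j := h (Zs j w) + h (Znus j w).
  transitivity (\sum_(j < N) (N%:R * (1 + a j) - b j / 2 * ((\sum_(l < N) b l) / 2))).
    apply: eq_bigr => j _; transitivity (\sum_(l < N) (1 + a j - b j / 2 * (b l / 2))) => //.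
    by rewrite sumrB sumr_const card_ord -[_ *+ N]mulr_natl -mulr_sumr -mulr_suml.
  have -> : \sum_(j < N) h (Zs j w) * h (Znus j w) = \sum_(j < N) a j by [].
  have -> : \sum_(j < N) (h (Zs j w) + h (Znus j w)) = \sum_(j < N) b j by [].
  rewrite sumrB -mulr_sumr big_split /= sumr_const card_ord -!mulr_suml.
  by field.
rewrite /quad_sum (eq_bigr _ (fun tau _ => E tau)) -mulr_sumr big_split /=.
rewrite -(natr_sum R _ _ (fun=> 1%N)) sum_ltn_pairs /quad_count.
rewrite -[estimator _ _ _ _ _]/('C(N, 2)%:R^-1 * \sum_(tau : 'I_N * 'I_N | (tau.1 < tau.2)%N) e tau).
by move: (\sum_(tau | _) _) => x; field; rewrite n0 c0.
Qed.

(** The average of the kernel over a pair of independent copies of [T0] is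
    [1 + V p q]; the sample consists of independent copies [T j] of [T0] and [Ws k]
    of [Z]. *)
Section Sample.
Context d (Omega : measurableType d) (P : probability Omega R).
Variables (Z : Omega -> borelM) (T0 : Omega -> borelM * borelM) (V : M -> M -> R).
Hypotheses (mZ : measurable_fun setT Z) (mT0 : measurable_fun setT T0).
Hypothesis kernel_average : forall p q : M,
  (\int[P]_w \int[P]_w' (kernel p q (T0 w) (T0 w'))%:E = (1 + V p q)%:E)%E.

Variables Zs Znus Ws : nat -> {RV P >-> borelM}.
Let T j : Omega -> borelM * borelM := fun w => (Zs j w, Znus j w).
Hypothesis T_law : forall j, same_law P (T j) T0.
Hypothesis Ws_law : forall k, same_law P (Ws k) Z.
Let family (s : nat + nat) : set (set Omega) :=
  match s with inl j => sigma_of (T j) | inr k => sigma_of (Ws k) end.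
Hypothesis family_indep : mutually_independent P family.

Let mT j : measurable_fun setT (T j).
Proof. by apply: measurable_fun_pair; exact: measurable_funPT. Qed.

Let mW k : measurable_fun setT (Ws k). Proof. exact: measurable_funPT. Qed.

Let family_measurable s : family s `<=` measurable.
Proof. by case: s => [j|k]; exact: sigma_of_measurable. Qed.

Let family_setI s : setI_closed (family s).
Proof. by case: s => [j|k]; exact: sigma_of_setI. Qed.

Let family_setT s : family s setT.
Proof. by case: s => [j|k]; exact: sigma_of_setT. Qed.

Let group_T (s : seq (nat + nat)) j : inl j \in s ->
  measurable_fun setT (T j : group_type family s -> borelM * borelM).
Proof. by move=> js; exact: (group_measurable (F := family) js). Qed.

Let group_W (s : seq (nat + nat)) k : inr k \in s ->
  measurable_fun setT (Ws k : group_type family s -> borelM).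
Proof. by move=> ks; exact: (group_measurable (F := family) ks). Qed.

Lemma sample_kernel_integral (p q : M) j l : j != l ->
  (\int[P]_w (kernel p q (T j w) (T l w))%:E = (1 + V p q)%:E)%E.
Proof.
move=> jl; rewrite -kernel_average.
have T_indep : independent_sets P (sigma_of (T j)) (sigma_of (T l)).
  exact: (mutually_independent_pair (F := family) (i := inl j) (j := inl l)).
pose F (t : (borelM * borelM) * (borelM * borelM)) : \bar R := (kernel p q t.1 t.2)%:E.
apply: (@independent_same_law_integral _ _ _ P _ _ _ _ (T j) T0 (T l) T0 F
  (mT j) mT0 (mT l) mT0 T_indep (T_law j) (T_law l)).
  apply/measurable_EFinP.
  by apply: (measurable_kernel (p := cst (p : borelM)) (q := cst (q : borelM))
    (t := fst) (t' := snd)); [exact: measurable_cst|exact: measurable_cst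
    |exact: measurable_fst|exact: measurable_snd].
by move=> t; rewrite lee_fin; have /andP[] := kernel02 p q t.1 t.2.
Qed.

(** By Fubini, as [1 + V p q] is the integral of a kernel depending measurably
    on [p] and [q]. *)
Lemma measurable_average : measurable_fun setT (fun z : borelM * borelM => 1 + V z.1 z.2).
Proof.
apply/measurable_EFinP.
have -> : EFin \o (fun z : borelM * borelM => 1 + V z.1 z.2) =
    fubini_F P (fun y : (borelM * borelM) * Omega =>
      (kernel y.1.1 y.1.2 (T 0%N y.2) (T 1%N y.2))%:E).
  by apply/funext => z; rewrite /= -(@sample_kernel_integral z.1 z.2 0%N 1%N).
apply: measurable_fun_fubini_tonelli_F => [|y]; last first.
  by rewrite lee_fin; have /andP[] := kernel02 y.1.1 y.1.2 (T 0%N y.2) (T 1%N y.2).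
apply/measurable_EFinP.
apply: (measurable_kernel (p := fun y : (borelM * borelM) * Omega => y.1.1)
  (q := fun y => y.1.2) (t := fun y => T 0%N y.2) (t' := fun y => T 1%N y.2)).
- exact: measurableT_comp measurable_fst measurable_fst.
- exact: measurableT_comp measurable_snd measurable_fst.
- exact: measurableT_comp (mT 0%N) measurable_snd.
- exact: measurableT_comp (mT 1%N) measurable_snd.
Qed.

Lemma average02 (p q : M) : 0 <= 1 + V p q <= 2.
Proof.
have -> : 1 + V p q = fine (\int[P]_w (kernel p q (T 0%N w) (T 1%N w))%:E)%E.
  by rewrite sample_kernel_integral.
apply: prob_integral_bounds => [|w]; last exact: kernel02.
by apply: (measurable_kernel (p := cst (p : borelM)) (q := cst (q : borelM))
  (t := T 0%N) (t' := T 1%N)) => //; exact: measurable_cst.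
Qed.

Lemma average_integral (U1 U2 : Omega -> borelM) :
  measurable_fun setT U1 -> measurable_fun setT U2 ->
  independent_sets P (sigma_of U1) (sigma_of U2) ->
  same_law P U1 Z -> same_law P U2 Z ->
  (\int[P]_w (1 + V (U1 w) (U2 w))%:E =
   \int[P]_w \int[P]_w' (1 + V (Z w) (Z w'))%:E)%E.
Proof.
move=> mU1 mU2 U12 U1Z U2Z.
pose F (z : borelM * borelM) : \bar R := (1 + V z.1 z.2)%:E.
apply: (@independent_same_law_integral _ _ _ P _ _ _ _ U1 Z U2 Z F
  mU1 mZ mU2 mZ U12 U1Z U2Z).
  by apply/measurable_EFinP; exact: measurable_average.
by move=> z; rewrite lee_fin; have /andP[] := average02 z.1 z.2.
Qed.

Variables Z1 Z2 : {RV P >-> borelM}.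
Hypotheses (Z1_law : same_law P Z1 Z) (Z2_law : same_law P Z2 Z).
Hypothesis Z12_indep : independent_sets P (sigma_of Z1) (sigma_of Z2).

Definition average : R := fine 'E_P[fun w => V (Z1 w) (Z2 w)]%E.

Lemma averageE : (\int[P]_w (1 + V (Z1 w) (Z2 w))%:E = (1 + average)%:E)%E.
Proof.
pose VZ w := V (Z1 w) (Z2 w).
have iVZ : P.-integrable setT (EFin \o VZ).
  apply: (@prob_bounded_integrable _ _ _ _ _ 1) => [|w].
    have -> : VZ = (fun w => (1 + V (Z1 w) (Z2 w)) - 1).
      by apply/funext => w; rewrite addrAC subrr add0r.
    apply: measurable_funB => //.
    exact: (measurableT_comp measurable_average
      (measurable_fun_pair (measurable_funPT Z1) (measurable_funPT Z2))).
  have := average02 (Z1 w) (Z2 w); rewrite -/(VZ w) => ?.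
  by rewrite ler_norml; apply/andP; split; lra.
transitivity (\int[P]_w (1 + 1 * VZ w + 0 * VZ w)%:E)%E.
  by apply: eq_integral => w _; rewrite mul1r mul0r addr0.
by rewrite integral_affine// mul1r mul0r addr0 /average expectation.unlock.
Qed.

Let WW (q : nat * nat) w : borelM * borelM := (Ws q.1 w, Ws q.2 w).
Let TT (q : nat * nat) w : (borelM * borelM) * (borelM * borelM) := (T q.1 w, T q.2 w).
Let KK (q : (nat * nat) * (nat * nat)) w := (WW q.1 w, TT q.2 w).
Let kernel_of (z : (borelM * borelM) * ((borelM * borelM) * (borelM * borelM))) : R :=
  kernel z.1.1 z.1.2 z.2.1 z.2.2.

Definition sample_kernel (q : (nat * nat) * (nat * nat)) (w : Omega) : R :=
  kernel (Ws q.1.1 w) (Ws q.1.2 w)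
    (Zs q.2.1 w, Znus q.2.1 w) (Zs q.2.2 w, Znus q.2.2 w).

Let mWW q : measurable_fun setT (WW q).
Proof. by apply: measurable_fun_pair; exact: mW. Qed.

Let mTT q : measurable_fun setT (TT q). Proof. exact: measurable_fun_pair. Qed.

Let mKK q : measurable_fun setT (KK q). Proof. exact: measurable_fun_pair. Qed.

Let kernel_of_ge0 z : 0 <= kernel_of z.
Proof. by have /andP[] := kernel02 z.1.1 z.1.2 z.2.1 z.2.2. Qed.

Let measurable_kernel_of : measurable_fun setT kernel_of.
Proof.
apply: (measurable_kernel (p := fun z : (borelM * borelM) *
    ((borelM * borelM) * (borelM * borelM)) => z.1.1) (q := fun z => z.1.2)
  (t := fun z => z.2.1) (t' := fun z => z.2.2)).
- exact: measurableT_comp measurable_fst measurable_fst.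
- exact: measurableT_comp measurable_snd measurable_fst.
- exact: measurableT_comp measurable_fst measurable_snd.
- exact: measurableT_comp measurable_snd measurable_snd.
Qed.

Lemma measurable_sample_kernel q : measurable_fun setT (sample_kernel q).
Proof. exact: measurableT_comp measurable_kernel_of (mKK q). Qed.

Lemma sample_kernel02 q w : 0 <= sample_kernel q w <= 2.
Proof. exact: kernel02. Qed.

(** Integrate first over the pair [(T j, T l)], independent of [(W k1, W k2)], then
    over the latter. *)
Lemma sample_kernel_mean q : good_quad q ->
  (\int[P]_w (sample_kernel q w)%:E = (1 + average)%:E)%E.
Proof.
move=> /andP[q1 q2].
have u : uniq ([:: inr q.1.1; inr q.1.2] ++ [:: inl q.2.1; inl q.2.2] : seq (nat + nat)).
  by rewrite /= !inE /= !andbT; apply/andP; split; [rewrite [_ == _]ltn_eqF|exact: q2].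
have WT_indep : independent_sets P (sigma_of (WW q.1)) (sigma_of (TT q.2)).
  apply: (group_independent family_measurable family_setI family_setT family_indep u).
  - by apply: measurable_fun_pair; apply: group_W; rewrite !inE eqxx ?orbT.
  - by apply: measurable_fun_pair; apply: group_T; rewrite !inE eqxx ?orbT.
apply: (etrans (@independent_integral _ _ _ P _ _ _ _ (WW q.1) (TT q.2)
  (fun z => (kernel_of z)%:E) (mWW _) (mTT _) WT_indep _ _)).
- by apply/measurable_EFinP; exact: measurable_kernel_of.
- by move=> z; rewrite lee_fin; exact: kernel_of_ge0.
have W_indep : independent_sets P (sigma_of (Ws q.1.1)) (sigma_of (Ws q.1.2)).
  apply: (mutually_independent_pair (F := family) (i := inr q.1.1) (j := inr q.1.2)) => //.
  by rewrite [_ == _]ltn_eqF.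
rewrite -averageE (average_integral _ _ Z12_indep)//.
rewrite -(average_integral (mW q.1.1) (mW q.1.2) W_indep)//.
by apply: eq_integral => w _; rewrite -(sample_kernel_integral _ _ q2).
Qed.

Lemma average_bounds : 0 <= 1 + average <= 2.
Proof.
have -> : 1 + average = fine (\int[P]_w (sample_kernel ((0, 1), (0, 1))%N w)%:E)%E.
  by rewrite sample_kernel_mean.
by apply: prob_integral_bounds; [exact: measurable_sample_kernel|exact: sample_kernel02].
Qed.

Lemma sample_kernel_independent q r : good_quad q -> good_quad r -> disjoint_quads q r ->
  independent_sets P (sigma_of (KK q)) (sigma_of (KK r)).
Proof.
move: q r => [[k1 k2] [j l]] [[k1' k2'] [j' l']] /andP[/= k12 jl] /andP[/= k12' jl'].
rewrite /disjoint_quads /= => /and5P[d1 d2 d3 d4 /and4P[e1 e2 e3 e4]].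
pose grp (x y z t : nat) : seq (nat + nat) := [:: inr x; inr y; inl z; inl t].
have u : uniq (grp k1 k2 j l ++ grp k1' k2' j' l').
  rewrite /grp /= !inE /= !negb_or !andbT.
  by repeat (apply/andP; split) => //; rewrite [_ == _]ltn_eqF.
have mgrp x y z t : measurable_fun setT
    (KK ((x, y), (z, t)) : group_type family (grp x y z t) -> _).
  by apply: measurable_fun_pair; apply: measurable_fun_pair;
    (apply: group_W || apply: group_T); rewrite !inE eqxx ?orbT.
exact: (group_independent family_measurable family_setI family_setT family_indep u
  (mgrp _ _ _ _) (mgrp _ _ _ _)).
Qed.

(** Disjoint quadruples use disjoint groups of sample points, so that the mean of the
    product is the product of the means. *)
Lemma sample_kernel_uncorrelated q r : good_quad q -> good_quad r -> disjoint_quads q r ->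
  (\int[P]_w ((sample_kernel q w - (1 + average)) *
              (sample_kernel r w - (1 + average)))%:E = 0)%E.
Proof.
move=> gq gr qr; set th := 1 + average; pose xi := sample_kernel.
have mxi s : measurable_fun setT (xi s) by exact: measurable_sample_kernel.
have xi0 s w : 0 <= xi s w by have /andP[] := sample_kernel02 s w.
have xi2 s w : xi s w <= 2 by have /andP[] := sample_kernel02 s w.
have ixi s : P.-integrable setT (EFin \o xi s).
  by apply: (@prob_bounded_integrable _ _ _ _ _ 2) => // w; rewrite ger0_norm.
have ixx : P.-integrable setT (EFin \o (fun w => xi q w * xi r w)).
  apply: (@prob_bounded_integrable _ _ _ _ _ (2 * 2)) => [|w]; first exact: measurable_funM.
  by rewrite ger0_norm ?mulr_ge0// ler_pM.
have fxi s : good_quad s -> fine (\int[P]_w (xi s w)%:E)%E = th.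
  by move=> gs; rewrite sample_kernel_mean.
have xxE : (\int[P]_w (xi q w * xi r w)%:E = (th * th)%:E)%E.
  apply: (etrans (@independent_integral _ _ _ P _ _ _ _ (KK q) (KK r)
    (fun z => (kernel_of z.1 * kernel_of z.2)%:E) (mKK _) (mKK _)
    (sample_kernel_independent gq gr qr) _ _)).
  - apply/measurable_EFinP; apply: measurable_funM.
      exact: measurableT_comp measurable_kernel_of measurable_fst.
    exact: measurableT_comp measurable_kernel_of measurable_snd.
  - by move=> z; rewrite lee_fin mulr_ge0.
  transitivity (\int[P]_w (0 + th * xi q w + 0 * xi q w)%:E)%E.
    apply: eq_integral => w _.
    transitivity (\int[P]_w' (0 + xi q w * xi r w' + 0 * xi r w')%:E)%E.
      by apply: eq_integral => w' _; rewrite /= mul0r addr0 add0r.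
    by rewrite integral_affine// fxi//; congr EFin; ring.
  by rewrite integral_affine// fxi//; congr EFin; ring.
transitivity (\int[P]_w (th * th + 1 * (xi q w * xi r w) + (- th) * (xi q w + xi r w))%:E)%E.
  by apply: eq_integral => w _; rewrite -/xi; congr EFin; ring.
have sE : (\int[P]_w (xi q w + xi r w)%:E = (th + th)%:E)%E.
  transitivity (\int[P]_w (0 + 1 * xi q w + 1 * xi r w)%:E)%E.
    by apply: eq_integral => w _; congr EFin; ring.
  by rewrite integral_affine// !fxi//; congr EFin; ring.
rewrite integral_affine//; last first.
  by rewrite (_ : EFin \o _ = ((EFin \o xi q) \+ (EFin \o xi r))%E)//; exact: integrableD.
by rewrite xxE sE /=; congr EFin; ring.
Qed.

Lemma estimator_cvg :
  {ae P, forall w, estimator Zs Znus Ws N w @[N --> \oo] --> average}.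
Proof.
have := quad_slln measurable_sample_kernel sample_kernel02 average_bounds
  sample_kernel_uncorrelated.
apply: filterS => w H.
have : quad_sum sample_kernel N w / quad_count N - 1 @[N --> \oo] --> (1 + average) - 1.
  by apply: cvgB => //; exact: cvg_cst.
rewrite (addrC 1 average) addrK; apply: cvg_trans; apply: near_eq_cvg.
exists 2%N => // N /= N2.
by rewrite (estimatorE Zs Znus Ws w N2) (addrC 1) addrK.
Qed.

End Sample.

End Kernel.

(** * Consistency *)

Section ConditionalVariance.
Context {R : realType} (m : nat) d (Omega : measurableType d) (P : probability Omega R).
Variables (X X' : {RV P >-> borel 'rV[R]_m}) (nu : {set 'I_m}).
Hypothesis X_indep : mutually_independent P (fun i : 'I_m => sigma_of (component X i)).
Hypothesis X'_law : same_law P X' X.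
Hypothesis X'_indep : mutually_independent P
  (fun b : bool => if b then sigma_of X else sigma_of X').

Lemma variance_pick_freeze (D : set (borel 'rV[R]_m)) : measurable D ->
  fine 'V_P[cond_exp P (sigma_coords X nu) (fun w => \1_D (X w))]%E =
  fine (\int[P]_w (\1_D (X w) * \1_D (pick_freeze nu X X' w))%:E)%E -
  fine (\int[P]_w (\1_D (X w))%:E)%E ^+ 2.
Proof.
move=> mD.
have HV := freeze_prob_is_cond_exp nu X_indep X'_law X'_indep mD.
have Gm : \bigcup_(i in [set` nu]) sigma_of (component X i) `<=` measurable.
  move=> _ [i _ [B mB <-]].
  exact: ((measurable_rowP _).1 (measurable_funPT X) i measurableT B mB).
have mV := cond_exp_measurable Gm HV.
rewrite (variance_cond_exp Gm HV) variance01//; last first.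
  by move=> w; exact: freeze_prob01.
rewrite -(pick_freeze_product nu X_indep X'_law X'_indep mD); congr (_ - fine _ ^+ 2).
have [_ _ /(_ setT)] := HV; apply.
exact: (@measurableT _ (g_sigma_algebraType
  (\bigcup_(i in [set` nu]) sigma_of (component X i)))).
Qed.

Context (M : completePMetricType R).
Hypothesis measurable_ball : forall d (T : measurableType d) (f g h : T -> borel M),
  measurable_fun setT f -> measurable_fun setT g -> measurable_fun setT h ->
  measurable [set w | geodesic_ball (f w : M) (g w) (h w)].
Variable f : borel 'rV[R]_m -> borel M.
Hypothesis mf : measurable_fun setT f.

Let T0 w : M * M := (f (X w), f (pick_freeze nu X X' w)).

(** With [h] and [hnu] the values of the indicator of [B_pq] at [f X] and at its
    pick-freeze copy, the double integral is [1 + E(h * hnu) - (E h)^2], as [h] and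
    [hnu] have the same law; the pick-freeze identity makes it one plus the variance. *)
Lemma kernel_conditional_variance (p q : M) :
  (\int[P]_w \int[P]_w' (kernel p q (T0 w) (T0 w'))%:E = (1 +
    fine 'V_P[cond_exp P (sigma_coords X nu) (fun w => ball_ind p q (f (X w) : M))])%:E)%E.
Proof.
pose D : set (borel 'rV[R]_m) := [set x | geodesic_ball p q (f x : M)].
have mD : measurable D.
  by apply: (measurable_ball (f := cst (p : borel M)) (g := cst (q : borel M)) (h := f)) => //;
    exact: measurable_cst.
have hD x : ball_ind p q (f x : M) = \1_D x by exact: ball_ind_indic.
have mI : measurable_fun setT (\1_D : borel 'rV[R]_m -> R) by exact: measurable_indic.
have I0 x : 0 <= \1_D x :> R by [].
have I1 x : \1_D x <= 1 :> R by rewrite -hD; have /andP[] := ball_ind01 p q (f x).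
pose hX w : R := \1_D (X w); pose hXnu w : R := \1_D (pick_freeze nu X X' w).
have mhX : measurable_fun setT hX by exact: measurableT_comp mI (measurable_funPT X).
have mhXnu : measurable_fun setT hXnu.
  exact: measurableT_comp mI (measurable_pick_freeze X X' nu).
have ihX : P.-integrable setT (EFin \o hX).
  apply: (@prob_bounded_integrable _ _ _ _ _ 1) => // w.
  by rewrite ger0_norm; [exact: I1|exact: I0].
have ihXnu : P.-integrable setT (EFin \o hXnu).
  apply: (@prob_bounded_integrable _ _ _ _ _ 1) => // w.
  by rewrite ger0_norm; [exact: I1|exact: I0].
pose u w := hX w * hXnu w; pose v w := (hX w + hXnu w) / 2.
have iu : P.-integrable setT (EFin \o u).
  apply: (@prob_bounded_integrable _ _ _ _ _ 1) => [|w]; first exact: measurable_funM.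
  by rewrite /u ger0_norm; [apply: mulr_ile1; (exact: I0 || exact: I1)
    |apply: mulr_ge0; exact: I0].
have iv : P.-integrable setT (EFin \o v).
  apply: (@prob_bounded_integrable _ _ _ _ _ 1) => [|w].
    by apply: measurable_funM => //; exact: measurable_funD.
  have := I0 (X w); have := I0 (pick_freeze nu X X' w).
  have := I1 (X w); have := I1 (pick_freeze nu X X' w).
  by rewrite -/(hX w) -/(hXnu w) => *; rewrite ger0_norm /v; lra.
rewrite (funext (fun w => hD (X w))) variance_pick_freeze//.
have hXnuE : (\int[P]_w (hXnu w)%:E = \int[P]_w (hX w)%:E)%E.
  apply: (pick_freeze_integral nu X_indep X'_law X'_indep (F := fun x => (\1_D x)%:E)).
    exact/measurable_EFinP.
  by move=> x; rewrite lee_fin.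
have vE : (\int[P]_w (v w)%:E = \int[P]_w (hX w)%:E)%E.
  transitivity (\int[P]_w (0 + 2^-1 * hX w + 2^-1 * hXnu w)%:E)%E.
    by apply: eq_integral => w _; rewrite /v add0r mulrDl ![_ / 2]mulrC.
  rewrite integral_affine// hXnuE -[RHS]fineK; last exact: integrable_fin_num ihX.
  by congr EFin; field.
set A := fine (\int[P]_w (u w)%:E)%E; set B := fine (\int[P]_w (hX w)%:E)%E.
transitivity (\int[P]_w (1 + 1 * u w + (- B) * v w)%:E)%E.
  apply: eq_integral => w _.
  transitivity (\int[P]_w' ((1 + u w) + 0 * v w' + (- v w) * v w')%:E)%E.
    apply: eq_integral => w' _; rewrite /kernel /= !hD; congr EFin.
    by rewrite /u /v /hX /hXnu; ring.
  by rewrite integral_affine// vE -/B; congr EFin; ring.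
by rewrite integral_affine// vE -/A -/B; congr EFin; ring.
Qed.

End ConditionalVariance.

Theorem mainTheorem3 (R : realType) (n : nat) (M : completePMetricType R)
  (g : orientedRiemannian R n M)
  (M_connected : connected [set: M])
  (M_separable : separable M)
  (M_distance : riemannian_distance g)
  (lam : {measure set (borel 'rV[R]_n) -> \bar R})
  (lam_lebesgue : is_lebesgue lam)
  (vol : {measure set (borel M) -> \bar R})
  (vol_volume : is_volume g lam vol)
  (disp : measure_display) (Omega : measurableType disp)
  (P : probability Omega R)
  (d : nat) (X X' : {RV P >-> borel 'rV[R]_d})
  (X_indep : mutually_independent P (fun i : 'I_d => sigma_of (component X i)))
  (X'_law : same_law P X' X)
  (X'_indep : mutually_independent P
     (fun b : bool => if b then sigma_of X else sigma_of X'))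
  (f : 'rV[R]_d -> M) (f_continuous : continuous f)
  (rho : borel M -> R)
  (rho_measurable : measurable_fun [set: borel M] rho)
  (rho_ge0 : forall z, 0 <= rho z)
  (Z_density : forall A : set (borel M), measurable A ->
     P ((f \o X) @^-1` A) = (\int[vol]_(z in A) (rho z)%:E)%E)
  (Z1 Z2 : {RV P >-> borel M})
  (Z1_law : same_law P Z1 (f \o X : Omega -> borel M))
  (Z2_law : same_law P Z2 (f \o X : Omega -> borel M))
  (XZ_indep : mutually_independent P (fun i : 'I_3 =>
     nth set0 [:: sigma_of X; sigma_of Z1; sigma_of Z2] i))
  (Z_geodesic : {ae P, forall w,
     exists gamma, unique_minimizing_geodesic (Z1 w) (Z2 w) gamma})
  (nu : {set 'I_d})
  (Zs Znus Ws : nat -> {RV P >-> borel M})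
  (Zs_law : forall j, same_law P
     (fun w => (Zs j w, Znus j w) : borel M * borel M)
     (fun w => (f (X w), f (pick_freeze nu X X' w)) : borel M * borel M))
  (Ws_law : forall k, same_law P (Ws k) (f \o X : Omega -> borel M))
  (sample_indep : mutually_independent P (fun s : nat + nat =>
     match s with
     | inl j => sigma_of (fun w => (Zs j w, Znus j w) : borel M * borel M)
     | inr k => sigma_of (Ws k)
     end)) :
  {ae P, forall w,
    estimator Zs Znus Ws N w @[N --> \oo] --> sensitivity P f nu X Z1 Z2}.
Proof.
have lenM : length_space M by exact: riemannian_length_space M_distance.
have properM (p : M) r : compact (cball p r).
  by apply: compact_cball => // x; exact: riemannian_locally_compact g x.
have [a dense_a] := separable_sequence M_separable.
have mball := measurable_geodesic_ball lenM properM dense_a.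
have mf : measurable_fun setT (f : borel 'rV[R]_d -> borel M).
  have oE : @measurable _ (borel M) = <<s @open M >> by [].
  apply: (measurability _ oE) => _ [U oU <-]; rewrite setTI.
  by apply: sub_sigma_algebra; apply: open_comp => // x _; exact: f_continuous.
have mZ : measurable_fun setT (f \o X : Omega -> borel M).
  exact: measurableT_comp mf (measurable_funPT X).
have mT0 : measurable_fun setT
    (fun w => (f (X w), f (pick_freeze nu X X' w)) : borel M * borel M).
  apply: measurable_fun_pair; first exact: mZ.
  exact: measurableT_comp mf (measurable_pick_freeze X X' nu).
have Z12_indep : independent_sets P (sigma_of Z1) (sigma_of Z2).
  pose i1 : 'I_3 := Ordinal (isT : 1 < 3)%N; pose i2 : 'I_3 := Ordinal (isT : 2 < 3)%N.
  apply: (mutually_independent_pair (i := i1) (j := i2) _ _ XZ_indep isT);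
    by apply: sigma_of_measurable; exact: measurable_funPT.
pose V (p q : M) :=
  fine 'V_P[cond_exp P (sigma_coords X nu) (fun w => ball_ind p q (f (X w)))]%E.
have kerV (p q : M) := kernel_conditional_variance nu X_indep X'_law X'_indep mball mf p q.
exact: (estimator_cvg (V := V) mball mZ mT0 kerV Zs_law Ws_law sample_indep
  Z1_law Z2_law Z12_indep).
Qed.
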